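(* Let $n\ge 2$ and $d$ be integers. Then $G(\alpha;n,d,n+1)$ is non-empty for some $\alpha\in\mathbb{R}$ if and only if $d\ge n$. Moreover, if $d\ge n$ and we write $d=na-t$ with integers $a,t$, $0\le t<n$, then $G(\alpha;n,d,n+1)$ is non-empty for every real $\alpha>t$.
   Context: Work on the projective line $\mathbb{P}^1$ over an algebraically closed field. A coherent system of type $(n,d,k)$ is a pair $(E,V)$ where $E$ is a vector bundle of rank $n$ and degree $d$ on $\mathbb{P}^1$ and $V\subset H^0(E)$ is a vector subspace of dimension $k$. For $\alpha\in\mathbb{R}$ its $\alpha$-slope is $\mu_\alpha(E,V)=\frac{d}{n}+\alpha\frac{k}{n}$. A coherent subsystem of $(E,V)$ is a coherent system $(E',V')$ with $E'$ a (nonzero) subbundle of $E$ and $V'\subset V\cap H^0(E')$; it is proper if $(E',V')\neq(E,V)$. $(E,V)$ is $\alpha$-stable if $\mu_\alpha(E',V')<\mu_\alpha(E,V)$ for every proper coherent subsystem $(E',V')$. $G(\alpha;n,d,k)$ denotes the moduli space of $\alpha$-stable coherent systems of type $(n,d,k)$ on $\mathbb{P}^1$. *)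

(* Defs.v *)
From mathcomp Require Import all_boot all_order all_algebra.
From mathcomp Require Import all_classical all_reals.

Set Implicit Arguments.
Unset Strict Implicit.
Unset Printing Implicit Defensive.

Import Order.TTheory GRing.Theory Num.Theory.

Local Open Scope classical_set_scope.
Local Open Scope ring_scope.

(* The projective line over k is handled through its function field k(x), its *)
(* closed points and the valuations they define. All nonempty opens contain   *)
(* the generic point, so a locally free sheaf embeds in the constant sheaf    *)
(* given by its generic stalk, a k(x)-vector space identified here with row   *)
(* vectors k(x)^n. A subsheaf of this constant sheaf is encoded by the family *)
(* of its stalks at the closed points; sections over an open U are then the   *)
(* vectors lying in the stalks at all points of U.                            *)

Notation ratfun k := {fraction {poly k}}.

(* Closed points, k being algebraically closed: Some c is the point x = c,    *)
(* None is the point at infinity.                                             *)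
Notation closed_point k := (option k).

Definition ord_poly (k : closedFieldType) (p : closed_point k)
    (f : {poly k}) : int :=
  if p is Some c then (mup c f)%:Z else - (size f)%:Z.

(* Order of vanishing at p; the value at f = 0 is irrelevant. *)
Definition ord (k : closedFieldType) (p : closed_point k) (f : ratfun k) :
    int :=
  ord_poly p \n_(repr f) - ord_poly p \d_(repr f).

Lemma ord_poly_mul (k : closedFieldType) (p : closed_point k)
    (f g : {poly k}) :
  f != 0 -> g != 0 ->
  ord_poly p (f * g) = ord_poly p f + ord_poly p g + (~~ p)%:Z.
Proof.
move=> f0 g0; case: p => [c|] /=; first by rewrite mupM // PoszD addr0.
rewrite size_mul //=; have : (0 < size f)%N by rewrite size_poly_gt0.
case: (size f) => // m _.
by rewrite addSn /= -[m.+1]addn1 !PoszD !opprD addrAC addrNK.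
Qed.

Lemma ord_quotient (k : closedFieldType) (p : closed_point k)
    (a b : {poly k}) :
  a != 0 -> b != 0 ->
  ord p (tofrac a / tofrac b) = ord_poly p a - ord_poly p b.
Proof.
move=> a0 b0; rewrite /ord; set f := (_ / _ : ratfun k).
set u := repr f; have d0 : \d_u != 0 by exact: denom_ratioP.
have fE : f = tofrac \n_u / tofrac \d_u.
  rewrite -(mulfK (_ : tofrac \d_u != 0) f) ?tofrac_eq0 //; congr (_ / _).
  rewrite -[f]reprK -/u; unlock tofrac; rewrite -[LHS]FracField.pi_mul.
  apply/eqmodP; rewrite /= FracField.equivfE /FracField.mulf.
  by rewrite !numden_Ratio ?mulf_neq0 ?oner_eq0 // !mulr1 mulrC.
have e : a * \d_u = \n_u * b.
  apply/eqP; rewrite -tofrac_eq !tofracM; apply/eqP.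
  move: fE; rewrite {1}/f => /eqP.
  by rewrite eqr_div ?tofrac_eq0 // => /eqP.
have n0 : \n_u != 0.
  by apply: contra_eq_neq e => ->; rewrite mul0r mulf_neq0.
have := congr1 (ord_poly p) e; rewrite !ord_poly_mul // => /addIr h.
by apply/eqP; rewrite subr_eq addrAC -subr_eq opprK h.
Qed.

(* The local ring at p. *)
Definition regular_at (k : closedFieldType) (p : closed_point k)
    (f : ratfun k) : Prop := f = 0 \/ 0 <= ord p f.

(* The submodule over the local ring at p generated by the rows of g. *)
Definition lattice (k : closedFieldType) (p : closed_point k) (r n : nat)
    (g : 'M[ratfun k]_(r, n)) : set 'rV[ratfun k]_n :=
  [set v | exists u : 'rV[ratfun k]_r,
             (forall j, regular_at p (u 0 j)) /\ v = u *m g].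

Definition stalks (k : closedFieldType) (n : nat) : Type :=
  closed_point k -> set 'rV[ratfun k]_n.

(* Vector bundles of rank r: near each p the rows of some g form a frame. The *)
(* open neighbourhoods of p are the complements of the finite sets s not      *)
(* containing p.                                                              *)
Definition vector_bundle (k : closedFieldType) (n r : nat) (E : stalks k n) :
    Prop :=
  forall p : closed_point k, exists (g : 'M[ratfun k]_(r, n))
      (s : seq (closed_point k)),
    [/\ row_free g, p \notin s & forall q, q \notin s -> E q = lattice q g].

(* F is a rank r subbundle of E, i.e. locally free with locally free quotient *)
(* E / F: near each p some local frame of E extends a local frame of F.       *)
Definition subbundle (k : closedFieldType) (n r : nat) (F E : stalks k n) :
    Prop :=
  forall p : closed_point k, exists (m : nat) (g : 'M[ratfun k]_(r, n))
      (g' : 'M[ratfun k]_(m, n)) (s : seq (closed_point k)),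
    [/\ row_free (col_mx g g'), p \notin s
      & forall q, q \notin s ->
          F q = lattice q g /\ E q = lattice q (col_mx g g')].

(* Degree of the determinant line bundle. The wedge b of the rows of B is a   *)
(* nonzero rational section of det E, and det E is generated at p by          *)
(* \det (h p) times b; so b vanishes at p to order - ord p (\det (h p)), and  *)
(* the degree is the degree of the divisor of b.                              *)
Definition has_degree (k : closedFieldType) (n r : nat) (E : stalks k n)
    (d : int) : Prop :=
  exists (B : 'M[ratfun k]_(r, n)) (h : closed_point k -> 'M[ratfun k]_r)
         (s : seq (closed_point k)),
    [/\ row_free B,
        forall p, h p \in unitmx /\ E p = lattice p (h p *m B),
        uniq s,
        forall p, p \notin s -> ord p (\det (h p)) = 0
      & d = \sum_(p <- s) - ord p (\det (h p))].

Definition global_sections (k : closedFieldType) (n : nat) (E : stalks k n) :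
    set 'rV[ratfun k]_n :=
  [set v | forall p, E p v].

(* V is a k-subspace of dimension m: the image of k^m under the injective     *)
(* k-linear map sending the standard basis to the rows of w.                  *)
Definition subspace_of_dim (k : closedFieldType) (n : nat)
    (V : set 'rV[ratfun k]_n) (m : nat) : Prop :=
  exists w : 'M[ratfun k]_(m, n),
    let comb (c : 'rV[k]_m) := map_mx (@tofrac _ \o polyC) c *m w in
    injective comb /\ V = range comb.

Record system (k : closedFieldType) (n : nat) := System {
  bundle : stalks k n;
  sections : set 'rV[ratfun k]_n
}.

Definition coherent_system (k : closedFieldType) (n r : nat) (d : int)
    (m : nat) (S : system k n) : Prop :=
  [/\ vector_bundle r (bundle S),
      has_degree r (bundle S) d,
      sections S `<=` global_sections (bundle S)
    & subspace_of_dim (sections S) m].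

Definition coherent_subsystem (k : closedFieldType) (n r : nat) (e : int)
    (m : nat) (S' S : system k n) : Prop :=
  [/\ (0 < r)%N,
      coherent_system r e m S',
      subbundle r (bundle S') (bundle S)
    & sections S' `<=` sections S].

Definition slope (R : realType) (alpha : R) (n : nat) (d : int) (m : nat) : R :=
  d%:~R / n%:R + alpha * (m%:R / n%:R).

(* Meaningful when S is a coherent system of type (n, d, m). *)
Definition stable (R : realType) (k : closedFieldType) (alpha : R) (n : nat)
    (d : int) (m : nat) (S : system k n) : Prop :=
  forall (r : nat) (e : int) (m' : nat) (S' : system k n),
    coherent_subsystem r e m' S' S -> S' <> S ->
    slope alpha r e m' < slope alpha n d m.

(* An isomorphism of bundles is determined by the map it induces on generic   *)
(* stalks.                                                                    *)
Definition isomorphic (k : closedFieldType) (n : nat) (S S' : system k n) :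
    Prop :=
  exists2 g : 'M[ratfun k]_n, g \in unitmx &
    (forall p, bundle S' p = mulmxr g @` bundle S p) /\
    sections S' = mulmxr g @` sections S.

(* The closed points of G(alpha; n, d, m): isomorphism classes of             *)
(* alpha-stable coherent systems of type (n, d, m).                           *)
Definition moduli (R : realType) (k : closedFieldType) (alpha : R) (n : nat)
    (d : int) (m : nat) : set (set (system k n)) :=
  [set C | exists S : system k n,
     [/\ coherent_system n d m S, stable alpha d m S
       & C = [set S' | isomorphic S S']]].

Arguments moduli {R} k alpha n d m.

(* Main.v *)
Require Import Defs.
From HB Require Import structures.
From mathcomp Require Import all_boot all_order all_algebra.
From mathcomp Require Import all_classical all_reals.
From mathcomp Require Import zify ring.

Import Order.TTheory GRing.Theory Num.Theory.
Local Open Scope classical_set_scope.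
Local Open Scope ring_scope.

Set Implicit Arguments.
Unset Strict Implicit.
Unset Printing Implicit Defensive.

(** Every bundle on the projective line splits into line bundles
    ([vector_bundle_split]), and degrees can be compared through determinants
    because a nonzero rational function has as many zeros as poles
    ([principal_divisor], [degree_le]). Both implications rest on these facts.

    Suppose that (E, V) of type (n, d, n+1) is stable. The subsystem (E, 0)
    shows alpha > 0. Write E as the sum of the O(a_i), so that the a_i add up
    to d, and let a_j be minimal. If d < n then a_j <= 0, hence the j-th
    coordinate of a global section is a constant, and the sections in V without
    j-th coordinate form a space of dimension at least n. Together with the
    summands other than O(a_j) they give a subsystem of rank n-1 and degree
    d - a_j >= d (n-1)/n, whose slope is therefore at least that of (E, V).
    So d >= n ([stable_degree_ge]).

    Conversely let d = n a - t >= n with 0 <= t < n, take for E the sum of t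
    copies of O(a-1) and n-t copies of O(a), and for V the span of the n+1 rows
    of the matrix with x on the diagonal and -1 just below it. All the summands
    have degree at least 1, so these rows are global sections. Their only
    linear relation over k(x) is, up to a factor, the one with coefficients
    1, x, ..., x^n. Since these are linearly independent over k, a subspace of V
    either is V or has a basis independent over k(x)
    ([linear_sections_rank]). Therefore a subsystem of rank r < n has at most r
    sections; its degree is at most r a, as all the twists are at most a
    ([subbundle_degree_le]). Its slope is at most a + alpha, whereas (E, V)
    has slope a + alpha + (alpha - t) / n, which is larger as soon as
    alpha > t. A proper subsystem of rank n has the same bundle and fewer
    sections, and alpha > 0 settles that case.

    The splitting is obtained by lattice reduction. Start from a basis of the
    generic stalk generating a sublattice of the stalk at p. While the
    sublattice is proper, some combination of the basis with constant
    coefficients is divisible by a uniformizer inside the stalk; substituting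
    the quotient for a basis vector that occurs in it lowers the order of the
    determinant ([saturate]). At a finite point this leaves the stalks at the
    other finite points alone, which yields a basis generating all of them
    ([finite_frame]). At infinity one keeps a basis up to powers of x and
    replaces the vector with the largest exponent, so that the step is
    polynomial on the affine line ([splitting]). *)

(** * The rational function field and its places *)

(** The fraction field of k[x] with its orders of vanishing, characterized up to
    isomorphism. Lattices, splittings and degrees depend on these properties
    alone, so the construction of fractions as classes of pairs stays out of
    the arguments. *)
Record ratField (k : closedFieldType) := RatField {
  ratfield :> fieldType;
  emb : {rmorphism {poly k} -> ratfield};
  ordf : closed_point k -> ratfield -> int;
  emb_eq0 : forall a, (emb a == 0) = (a == 0);
  ratfieldP : forall f, exists a b, b != 0 /\ f = emb a / emb b;
  ordf_quotient : forall p a b, a != 0 -> b != 0 ->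
    ordf p (emb a / emb b) = ord_poly p a - ord_poly p b
}.

Arguments emb_eq0 {k r}.
Arguments ratfieldP {k r}.
Arguments ordf_quotient {k r} p {a b}.

Section Valuation.
Context {k : closedFieldType} {K : ratField k}.
Implicit Types (p : closed_point k) (f g : K) (a b : {poly k}).
Local Notation ord := (@ordf k K).

Definition cst : k -> K := emb K \o polyC.
HB.instance Definition _ := GRing.RMorphism.on cst.
Definition ratX : K := emb K 'X.

Lemma ratfield_neq0P f : f != 0 ->
  exists a b, [/\ a != 0, b != 0 & f = emb K a / emb K b].
Proof.
have [a [b [b0 ->]]] := ratfieldP f => f0; exists a, b; split=> //.
by apply: contra_neq f0 => ->; rewrite rmorph0 mul0r.
Qed.

Lemma ordM p f g : f != 0 -> g != 0 -> ord p (f * g) = ord p f + ord p g.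
Proof.
move=> /ratfield_neq0P[a [b [a0 b0 ->]]] /ratfield_neq0P[c [e [c0 e0 ->]]].
rewrite mulf_div -!rmorphM !ordf_quotient ?mulf_neq0 // !ord_poly_mul //.
by rewrite !opprD addrACA [in RHS]addrACA addrA addrK.
Qed.

Lemma ord_1 p : ord p 1 = 0.
Proof.
have := @ordf_quotient k K p 1 1 (oner_neq0 _) (oner_neq0 _).
by rewrite divff ?emb_eq0 ?oner_eq0 // subrr.
Qed.

Lemma ordV p f : f != 0 -> ord p f^-1 = - ord p f.
Proof.
move=> f0; have := ordM p (_ : f^-1 != 0) f0; rewrite mulVf // ord_1 invr_eq0.
by move/(_ f0)/esym/eqP; rewrite addr_eq0 => /eqP.
Qed.

(** The ultrametric inequality at all points; at infinity it is the bound on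
    the degree of a sum. *)
Lemma ord_poly_leD p a b c : a + b != 0 ->
  (a != 0 -> (c <= ord_poly p a)) -> (b != 0 -> c <= ord_poly p b) ->
  c <= ord_poly p (a + b).
Proof.
have [->|a0] := eqVneq a 0; first by rewrite add0r => b0 _; apply.
have [->|b0] := eqVneq b 0; first by rewrite addr0 => _ + _; apply.
move=> ab0 /(_ isT) ca /(_ isT) cb.
have : c <= Order.min (ord_poly p a) (ord_poly p b) by rewrite le_min ca.
move/le_trans; apply.
case: p {ca cb} => [x|] /=.
  rewrite ge_min !lez_nat !mup_geq //.
  have [le|/ltnW le] := leqP (mup x a) (mup x b).
    by rewrite dvdp_add // -?mup_geq.
  by rewrite orbC dvdp_add // -?mup_geq.
rewrite ge_min !lerN2 !lez_nat -leq_max; exact: size_polyD.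
Qed.

(** The local ring at p. *)
Definition reg p : {pred K} := fun f => (f == 0) || (0 <= ord p f).

Lemma regE p f : f != 0 -> (f \in reg p) = (0 <= ord p f).
Proof. by rewrite unfold_in => /negbTE->. Qed.

Lemma ordN p f : ord p (- f) = ord p f.
Proof.
have [->|f0] := eqVneq f 0; first by rewrite oppr0.
have N10 : -1 != 0 :> K by rewrite oppr_eq0 oner_eq0.
have e : ord p (-1) = 0.
  have := ordM p N10 N10; rewrite mulrNN mulr1 ord_1 => /esym/eqP.
  by rewrite -mulr2n mulrn_eq0 => /eqP.
by rewrite -mulN1r (ordM p N10 f0) e add0r.
Qed.

Lemma reg_subring p : subring_closed (reg p).
Proof.
have regM f g : f \in reg p -> g \in reg p -> f * g \in reg p.
  have [->|f0] := eqVneq f 0; first by rewrite mul0r.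
  have [->|g0] := eqVneq g 0; first by rewrite mulr0.
  rewrite (regE p f0) (regE p g0) (regE p (mulf_neq0 f0 g0)) (ordM p f0 g0).
  exact: addr_ge0.
split=> //; first by rewrite regE ?oner_eq0 // ord_1.
move=> f g; have [->|f0] := eqVneq f 0.
  by rewrite sub0r !unfold_in oppr_eq0 ordN.
have [->|g0] := eqVneq g 0; first by rewrite subr0.
have [->|fg0] := eqVneq (f - g) 0; first by rewrite !unfold_in eqxx.
rewrite !regE //; case: (ratfield_neq0P f0) (ratfield_neq0P g0) fg0.
move=> a [b [a0 b0 ->]] [c [e [c0 e0 ->]]].
rewrite -mulNr -rmorphN addf_div ?emb_eq0 // -!rmorphM -rmorphD mulNr.
rewrite mulf_eq0 invr_eq0 !emb_eq0 mulf_eq0 (negbTE b0) (negbTE e0) !orbF.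
move=> s0; rewrite !ordf_quotient ?mulf_neq0 // !subr_ge0 => ab ce.
apply: ord_poly_leD => // _; rewrite -?mulNr !ord_poly_mul ?oppr_eq0 //.
  by rewrite lerD2r lerD2r.
have <- : ord_poly p c = ord_poly p (- c).
  case: (p) => [x|] /=; last by rewrite size_polyN.
  by rewrite -mulN1r mupMr // rootE hornerN hornerC oppr_eq0 oner_eq0.
by rewrite lerD2r [leLHS]addrC lerD2r.
Qed.
HB.instance Definition _ p :=
  GRing.isSubringClosed.Build _ (reg p) (@reg_subring p).

Lemma regV p f : f != 0 -> ord p f = 0 -> f^-1 \in reg p.
Proof. by move=> f0 e; rewrite regE ?invr_eq0 // ordV // e. Qed.

Lemma cst_eq0 (c : k) : (cst c == 0) = (c == 0).
Proof. by rewrite /cst /= emb_eq0 polyC_eq0. Qed.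

Lemma ord_emb p a : a != 0 -> ord p (emb K a) = ord_poly p a - ord_poly p 1.
Proof.
by move=> a0; rewrite -(@ordf_quotient k K) ?oner_eq0 // rmorph1 divr1.
Qed.

Lemma mup1 (c : k) : mup c 1 = 0%N.
Proof. by rewrite mupNroot // root1. Qed.

Lemma ord_cst p (c : k) : c != 0 -> ord p (cst c) = 0.
Proof.
move=> c0; rewrite ord_emb ?polyC_eq0 //; case: p => [x|] /=.
  by rewrite !mupNroot ?rootC ?oner_eq0 // subrr.
by rewrite size_polyC c0 size_poly1 subrr.
Qed.

Lemma reg_cst p (c : k) : cst c \in reg p.
Proof.
have [->|c0] := eqVneq c 0; first by rewrite rmorph0 rpred0.
by rewrite regE ?cst_eq0 // ord_cst.
Qed.

Lemma reg_poly (c : k) a : emb K a \in reg (Some c).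
Proof.
have [->|a0] := eqVneq a 0; first by rewrite rmorph0 rpred0.
by rewrite regE ?emb_eq0 // ord_emb //= mup1 subr0.
Qed.

Lemma reg_infty a b : b != 0 ->
  (emb K a / emb K b \in reg None) = (size a <= size b)%N.
Proof.
move=> b0; have [->|a0] := eqVneq a 0.
  by rewrite rmorph0 mul0r rpred0 size_poly0.
rewrite regE ?mulf_neq0 ?invr_eq0 ?emb_eq0 // ordf_quotient //=.
by rewrite opprK addrC subr_ge0 lez_nat.
Qed.

Definition uniformizer p : K :=
  if p is Some c then emb K ('X - c%:P) else ratX^-1.

Lemma ratX_neq0 : ratX != 0.
Proof. by rewrite emb_eq0 polyX_eq0. Qed.

Lemma uniformizer_neq0 p : uniformizer p != 0.
Proof. by case: p => [c|] /=;
  rewrite ?invr_eq0 emb_eq0 ?polyXsubC_eq0 ?polyX_eq0. Qed.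

Lemma ord_XsubC (c : k) p : ord p (emb K ('X - c%:P)) =
  if p is Some c' then (c' == c)%:Z else -1.
Proof.
rewrite ord_emb ?polyXsubC_eq0 //; case: p => [c'|] /=.
  rewrite -['X - _]expr1 mup_XsubCX mup1 subr0.
  by case: eqVneq.
by rewrite size_XsubC size_poly1.
Qed.

Lemma ord_ratX p : ord p ratX = if p is Some c then (c == 0)%:Z else -1.
Proof. by have := ord_XsubC 0 p; rewrite subr0. Qed.

Lemma ord_uniformizer p : ord p (uniformizer p) = 1.
Proof.
by case: p => [c|] /=; rewrite ?ordV ?ratX_neq0 // ?ord_XsubC ?ord_ratX ?eqxx.
Qed.

Lemma ordX p f (i : int) : f != 0 -> ord p (f ^ i) = i * ord p f.
Proof.
move=> f0; have H m : ord p (f ^+ m) = m%:Z * ord p f.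
  elim: m => [|m IH]; first by rewrite expr0 ord_1 mul0r.
  by rewrite exprS ordM ?expf_neq0 // IH -addn1 PoszD mulrDl mul1r addrC.
case: i => m; first by rewrite -exprnP H.
by rewrite NegzE -exprnN ordV ?expf_neq0 // H mulNr.
Qed.


Lemma reg_finite (c : k) f : f \in reg (Some c) ->
  exists a b, b.[c] != 0 /\ f = emb K a / emb K b.
Proof.
have [->|] := eqVneq f 0.
  by exists 0, 1; rewrite hornerC oner_eq0 rmorph0 mul0r.
move=> f0; rewrite regE //;
  case: (ratfield_neq0P f0) => a [b [a0 b0 ->]] {f f0}.
have [m [a' + Ea]] := multiplicity_XsubC a c; rewrite a0 /= => ra.
have [l [b' + Eb]] := multiplicity_XsubC b c; rewrite b0 /= => rb.
rewrite ordf_quotient // {1}Ea {1}Eb /= !mupMr // !mup_XsubCX eqxx subr_ge0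
  lez_nat.
move=> lm; exists (a' * ('X - c%:P) ^+ (m - l)), b'; split=> //.
rewrite Ea Eb -[in LHS](subnK lm) exprD mulrA !rmorphM -mulf_div divff ?mulr1
  //.
by rewrite emb_eq0 expf_neq0 ?polyXsubC_eq0.
Qed.

(** The residue field at every point is k. *)
Lemma residue p f : f \in reg p ->
  exists c, (f - cst c) / uniformizer p \in reg p.
Proof.
case: p => [x|].
  move=> /reg_finite[a [b [bx ->]]]; exists (a.[x] / b.[x]).
  have b0 : b != 0 by apply: contra_neq bx => ->; rewrite horner0.
  have : root (a - (a.[x] / b.[x])%:P * b) x.
    by rewrite rootE !hornerE divfK // subrr.
  move/factor_theorem => [q]; set c := _ / _ => Eq.
  have -> : emb K a / emb K b - cst c = emb K (q * ('X - x%:P)) / emb K b.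
    by rewrite -Eq rmorphB [in RHS]rmorphM mulrBl mulfK ?emb_eq0.
  rewrite /= rmorphM mulrAC mulfK ?emb_eq0 ?polyXsubC_eq0 //.
  rewrite rpredM ?reg_poly // regV ?emb_eq0 // ord_emb //=.
  by rewrite !mupNroot ?rootC ?oner_eq0 ?subrr.
have [a [b [b0 ->]]] := ratfieldP f; rewrite reg_infty // => ab.
(* c is the value at infinity, 0 when the degree of a is below that of b *)
pose c := a`_(size b).-1 / lead_coef b; exists c.
have -> : emb K a / emb K b - cst c = emb K (a - c *: b) / emb K b.
  by rewrite -mul_polyC rmorphB [in RHS]rmorphM mulrBl mulfK ?emb_eq0.
rewrite /= invrK mulrAC -rmorphM reg_infty //.
have [->|ac0] := eqVneq (a - c *: b) 0; first by rewrite mul0r size_poly0.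
rewrite size_mulX //; have sb : (0 < size b)%N by rewrite size_poly_gt0.
rewrite -(ltn_predK sb) ltnS; apply/leq_sizeP => j; rewrite leq_eqVlt.
case/predU1P => [<-|]; rewrite coefB coefZ.
  by rewrite /c /lead_coef divfK ?subrr // -/(lead_coef b) lead_coef_eq0.
by rewrite (ltn_predK sb) => jb;
  rewrite !nth_default ?mulr0 ?subr0 // (leq_trans ab).
Qed.

(** The divisor of a rational function has degree 0. The sum is taken over any
    finite set containing a suitable support, so that the statement is
    multiplicative in f; it is then enough to treat constants and the
    polynomials X - c, whose only pole is at infinity. *)
Lemma principal_divisor f : f != 0 -> exists s0 : seq (closed_point k),
  forall s, uniq s -> {subset s0 <= s} -> \sum_(p <- s) ord p f = 0.
Proof.
pose P f := exists s0 : seq (closed_point k),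
  forall s, uniq s -> {subset s0 <= s} -> \sum_(p <- s) ord p f = 0.
have PM g h : g != 0 -> h != 0 -> P g -> P h -> P (g * h).
  move=> g0 h0 [s1 H1] [s2 H2]; exists (s1 ++ s2) => s us s12.
  rewrite (eq_bigr (fun p => ord p g + ord p h)) => [|p _]; last exact: ordM.
  by rewrite big_split /= H1 ?H2 // => p ps; apply: s12;
    rewrite mem_cat ps ?orbT.
have PV g : g != 0 -> P g -> P g^-1.
  move=> g0 [s1 H1]; exists s1 => s us ss;
    rewrite (eq_bigr (fun p => - ord p g)).
    by rewrite sumrN H1 ?oppr0.
  by move=> p _; rewrite ordV.
have Pp a : a != 0 -> P (emb K a).
  move=> a0; have [r Ea] := closed_field_poly_normal a.
  rewrite Ea -mul_polyC rmorphM; apply: (PM).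
  - by rewrite emb_eq0 polyC_eq0 lead_coef_eq0.
  - by rewrite emb_eq0 monic_neq0 ?monic_prod_XsubC.
  - exists [::] => s _ _; apply: big1 => p _; apply: (@ord_cst p (lead_coef a)).
    by rewrite lead_coef_eq0.
  elim: r {Ea} => [|c r IH].
    by rewrite big_nil rmorph1; exists [::] => s _ _; apply: big1 => p _;
      exact: ord_1.
  rewrite big_cons rmorphM; apply: (PM) => //.
  - by rewrite emb_eq0 polyXsubC_eq0.
  - by rewrite emb_eq0 monic_neq0 ?monic_prod_XsubC.
  exists [:: Some c; None] => s us ss.
  rewrite (bigD1_seq (Some c)) ?ss ?inE ?eqxx //= -big_filter.
  rewrite (bigD1_seq None) ?filter_uniq ?mem_filter ?ss ?inE ?eqxx ?orbT //=.
  rewrite !ord_XsubC eqxx -big_filter big1_seq ?addr0 //= => p.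
  rewrite !mem_filter => /andP[p1 /andP[p2 _]].
  rewrite ord_XsubC; case: p p1 p2 => [c'|//] _.
  by case: (eqVneq c' c) => // ->; rewrite eqxx.
move=> /ratfield_neq0P[a [b [a0 b0 ->]]]; apply: (PM);
  rewrite ?invr_eq0 ?emb_eq0 //.
  exact: Pp.
by apply: (PV); rewrite ?emb_eq0 //; exact: Pp.
Qed.

(** Subtract the residue at infinity: the difference would have a zero and no
    pole. *)
Lemma global_regular f : (forall p, f \in reg p) -> exists c, f = cst c.
Proof.
move=> fr; have [c fc] := residue (fr None); exists c; apply/eqP.
rewrite -subr_eq0; apply: contraT => g0; set g := f - cst c in fc g0.
have gr p : 0 <= ord p g.
  by rewrite -(regE _ g0); apply: rpredB; [exact: fr|exact: reg_cst].
have [s0 H] := principal_divisor g0.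
have := H (undup (None :: s0)) (undup_uniq _);
  rewrite (bigD1_seq None) ?undup_uniq ?mem_undup ?inE ?eqxx //.
move=> /(_ _)/eqP; rewrite paddr_eq0 ?sumr_ge0 // => E.
have /andP[/eqP o0 _] : (ord None g == 0) &&
    (\sum_(i <- undup (None :: s0) | i != None) ord i g == 0).
  by apply: E => p ps; rewrite mem_undup inE ps orbT.
have u0 : (uniformizer None)^-1 != 0 by rewrite invr_eq0 uniformizer_neq0.
move: fc; rewrite (regE _ (mulf_neq0 g0 u0)) (ordM _ g0 u0) o0.
by rewrite ordV ?uniformizer_neq0 // ord_uniformizer.
Qed.

End Valuation.

(** * Lattices over the local rings *)

Section Lattices.
Context {k : closedFieldType} {K : ratField k}.
Implicit Types (p : closed_point k).
Local Notation ord := (@ordf k K).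

Definition lat p (r n : nat) (g : 'M[K]_(r, n)) : set 'rV[K]_n :=
  [set v | exists2 u : 'rV[K]_r, u \is a mxOver (reg p) & v = u *m g].

Lemma lat_row p r n (g : 'M[K]_(r, n)) i : lat p g (row i g).
Proof.
exists (delta_mx 0 i); last by rewrite rowE.
by apply/mxOverP => a b; rewrite mxE; case: (_ && _);
  [exact: rpred1|exact: rpred0].
Qed.

Lemma latD p r n (g : 'M[K]_(r, n)) v w :
  lat p g v -> lat p g w -> lat p g (v + w).
Proof.
move=> [u1 h1 ->] [u2 h2 ->]; exists (u1 + u2); last by rewrite mulmxDl.
exact: rpredD.
Qed.

Lemma lat0 p r n (g : 'M[K]_(r, n)) : lat p g 0.
Proof. by exists 0; [exact: rpred0|rewrite mul0mx]. Qed.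

Lemma latZ p r n (g : 'M[K]_(r, n)) f v :
  f \in reg p -> lat p g v -> lat p g (f *: v).
Proof.
move=> fp [u h ->]; exists (f *: u); last by rewrite scalemxAl.
by apply/mxOverP => a b; rewrite mxE rpredM // (mxOverP h).
Qed.

Lemma lat_sum p r n (g : 'M[K]_(r, n)) (I : finType) (P : pred I)
    (F : I -> 'rV[K]_n) :
  (forall i, P i -> lat p g (F i)) -> lat p g (\sum_(i | P i) F i).
Proof. by move=> h; elim/big_ind: _; [exact: lat0|exact: latD|exact: h]. Qed.

Lemma lat_sub p r r' n (g : 'M[K]_(r, n)) (g' : 'M[K]_(r', n)) :
  (forall i, lat p g' (row i g)) -> lat p g `<=` lat p g'.
Proof.
move=> h v [u up ->]; rewrite mulmx_sum_row; apply: lat_sum => i _.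
by apply: latZ => //; exact: (mxOverP up).
Qed.

Lemma lat_subP p r r' n (g : 'M[K]_(r, n)) (g' : 'M[K]_(r', n)) :
  lat p g `<=` lat p g' ->
  exists2 T : 'M[K]_(r, r'), T \is a mxOver (reg p) & g = T *m g'.
Proof.
move=> h; have /choice[u hu] : forall i, exists u : 'rV[K]_r',
    u \is a mxOver (reg p) /\ row i g = u *m g'.
  by move=> i; have [u ? ?] := h _ (lat_row p g i); exists u.
exists (\matrix_i u i).
  by apply/mxOverP => i j; rewrite mxE; have [/mxOverP] := hu i.
by apply/row_matrixP => i; rewrite row_mul rowK; have [] := hu i.
Qed.

Lemma det_reg p n (T : 'M[K]_n) : T \is a mxOver (reg p) -> \det T \in reg p.
Proof.
move=> /mxOverP Tp; apply: rpred_sum => s _.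
rewrite rpredM //; first by rewrite rpredX // rpredN rpred1.
by apply: rpred_prod => i _; exact: Tp.
Qed.

Lemma inv_reg p n (T : 'M[K]_n) : T \in unitmx -> T \is a mxOver (reg p) ->
  ord p (\det T) = 0 -> invmx T \is a mxOver (reg p).
Proof.
move=> Tu Tp T0; rewrite /invmx Tu; apply/mxOverP => i j; rewrite mxE.
have d0 : \det T != 0 by rewrite -unitfE -unitmxE.
rewrite rpredM ?(regV d0) // mxE /cofactor rpredM //.
  by rewrite rpredX // rpredN rpred1.
by apply: det_reg; apply/mxOverP => a b; rewrite !mxE (mxOverP Tp).
Qed.

Lemma lat_unit p n m (T : 'M[K]_n) (g : 'M[K]_(n, m)) : T \in unitmx ->
  T \is a mxOver (reg p) -> ord p (\det T) = 0 -> lat p (T *m g) = lat p g.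
Proof.
move=> Tu Tp T0; apply/seteqP; split=> v [u up ->].
  by exists (u *m T); rewrite ?mulmxA //; exact: mxOverM.
exists (u *m invmx T); last by rewrite mulmxA mulmxKV.
by apply: mxOverM => //; exact: inv_reg.
Qed.

(** The determinant is a polynomial in the entries, so it respects congruence
    modulo the maximal ideal. *)
Lemma det_congr p n (A B : 'M[K]_n) : A \is a mxOver (reg p) ->
  B \is a mxOver (reg p) ->
  (forall i j, (A i j - B i j) / uniformizer p \in reg p) ->
  (\det A - \det B) / uniformizer p \in reg p.
Proof.
move=> /mxOverP Ap /mxOverP Bp AB; pose z := uniformizer p : K.
pose R (f g : K) := [/\ f \in reg p, g \in reg p & (f - g) / z \in reg p].
have RM f g f' g' : R f g -> R f' g' -> R (f * f') (g * g').
  move=> [f1 g1 h1] [f2 g2 h2]; split; try by apply: rpredM.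
  have -> : (f * f' - g * g') / z = f * ((f' - g') / z) + g' * ((f - g) / z).
    rewrite !mulrA -mulrDl; congr (_ / _); rewrite !mulrBr [g' * f]mulrC.
    by rewrite addrA subrK [g' * g]mulrC.
  by apply: rpredD; exact: rpredM.
have RD f g f' g' : R f g -> R f' g' -> R (f + f') (g + g').
  move=> [f1 g1 h1] [f2 g2 h2]; split; try by apply: rpredD.
  by rewrite opprD addrACA mulrDl rpredD.
have Rr f : f \in reg p -> R f f.
  by move=> ?; split=> //; rewrite subrr mul0r rpred0.
suff [] : R (\det A) (\det B) by [].
apply: (big_ind2 R) => [|? ? ? ? |s _].
- exact/Rr/rpred0.
- exact: RD.
apply: (RM); first by apply: Rr; rewrite rpredX // rpredN rpred1.
apply: (big_ind2 R) => [|? ? ? ? |i _].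
- exact/Rr/rpred1.
- exact: RM.
by split.
Qed.

(** Let Q be the matrix of w in terms of h. If its determinant is not a unit at
    p, the reduction of Q to the residue field k is singular, and a vector l of
    its left kernel makes l Q divisible by the uniformizer. *)
Lemma saturate_step p n (w h : 'M[K]_n) : w \in unitmx -> h \in unitmx ->
  lat p w `<=` lat p h -> lat p w = lat p h \/
  exists2 l : 'rV[k]_n, l != 0 &
    lat p h ((uniformizer p)^-1 *: (map_mx cst l *m w)).
Proof.
move=> wu hu /lat_subP[Q Qp Ew].
have Qu : Q \in unitmx.
  by move: wu; rewrite Ew unitmx_mul => /andP[].
have [/eqP d0|d0] := boolP (ord p (\det Q) == 0).
  by left; rewrite Ew; exact: lat_unit.
right; have /choice[Q0' Q0P] : forall ij : 'I_n * 'I_n, exists c : k,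
   (Q ij.1 ij.2 - cst c) / uniformizer p \in reg p.
  by move=> [i j]; apply: residue; exact: (mxOverP Qp).
pose Q0 := \matrix_(i, j) Q0' (i, j).
have Q0p i j : (Q i j - map_mx cst Q0 i j) / uniformizer p \in reg p.
  by rewrite !mxE; exact: (Q0P (i, j)).
have : \det Q0 == 0.
  apply: contraT => D0.
  have rQ0 : map_mx (cst : k -> K) Q0 \is a mxOver (reg p).
    by apply/mxOverP => i j; rewrite mxE reg_cst.
  have := det_congr Qp rQ0 Q0p; rewrite det_map_mx => hd.
  have dQ0 : \det Q != 0 by rewrite -unitfE -unitmxE.
  have dQp := det_reg Qp.
  have u0 : (uniformizer p)^-1 != 0 :> K by rewrite invr_eq0 uniformizer_neq0.
  have dQz : \det Q / uniformizer p \in reg p.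
    rewrite (regE _ (mulf_neq0 dQ0 u0)) (ordM _ dQ0 u0) ordV ?uniformizer_neq0
      //.
    rewrite ord_uniformizer subr_ge0 -gtz0_ge1 lt0r d0.
    by rewrite -(regE _ dQ0).
  have : (cst (\det Q0) : K) / uniformizer p \in reg p.
    have -> : (cst (\det Q0) : K) / uniformizer p =
      \det Q / uniformizer p - (\det Q - cst (\det Q0)) / uniformizer p.
      by rewrite -mulrBl opprB addrC subrK.
    exact: rpredB.
  have c0 : (cst (\det Q0) : K) != 0 by rewrite cst_eq0.
  rewrite (regE _ (mulf_neq0 c0 u0)) (ordM _ c0 u0) ordV ?uniformizer_neq0 //.
  by rewrite ord_uniformizer ord_cst.
move=> /det0P[l l0 lQ]; exists l => //.
have -> : (uniformizer p)^-1 *: (map_mx cst l *m w) =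
  (map_mx cst l *m ((uniformizer p)^-1 *: (Q - map_mx cst Q0))) *m h.
  rewrite -scalemxAr -scalemxAl mulmxBr -map_mxM lQ map_mx0 subr0.
  by rewrite Ew mulmxA.
apply: ex_intro2 erefl; apply: mxOverM; apply/mxOverP => i j.
  by rewrite mxE reg_cst.
by have := Q0p i j; rewrite !mxE mulrC.
Qed.

End Lattices.

(** * Splitting of vector bundles *)

Section Splitting.
Context {k : closedFieldType} {K : ratField k}.
Implicit Types (p : closed_point k).
Local Notation ord := (@ordf k K).

Definition set_row (n : nat) (i : 'I_n) (v : 'rV[K]_n) (w : 'M[K]_n) :=
  \matrix_(a, b) (if a == i then v 0 b else w a b).

Lemma set_row_mul n (i : 'I_n) (v : 'rV[K]_n) (w : 'M[K]_n) :
  set_row i (v *m w) w = set_row i v 1%:M *m w.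
Proof.
apply/row_matrixP => a; rewrite row_mul; case: (eqVneq a i) => [->|ai].
  have -> : row i (set_row i v 1%:M) = v by apply/rowP => b; rewrite !mxE eqxx.
  by apply/rowP => b; rewrite mxE [LHS]mxE eqxx.
have -> : row a (set_row i v 1%:M) = row a 1%:M.
  by apply/rowP => b; rewrite !mxE (negbTE ai).
rewrite -row_mul mul1mx; apply/rowP => b.
by rewrite !mxE (negbTE ai).
Qed.

Lemma det_set_row n (i : 'I_n) (v : 'rV[K]_n) :
  \det (set_row i v 1%:M) = v 0 i.
Proof.
have adj1 : \adj (1%:M : 'M[K]_n) = 1%:M.
  by have := mul_mx_adj (1%:M : 'M[K]_n); rewrite mul1mx det1.
rewrite (expand_det_row _ i).
have cof j : cofactor (set_row i v 1%:M) i j = (j == i)%:R.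
  have -> : cofactor (set_row i v 1%:M) i j = cofactor 1%:M i j.
    rewrite /cofactor; congr (_ * \det _); apply/matrixP => a b.
    by rewrite !mxE eq_sym (negbTE (neq_lift _ _)).
  by have /matrixP/(_ j i) := adj1; rewrite !mxE.
rewrite (bigD1 i) //= big1 ?addr0 => [|j ji]; last first.
  by rewrite cof (negbTE ji) mulr0.
by rewrite cof eqxx mulr1 mxE eqxx.
Qed.

Lemma set_row_unit n (i : 'I_n) (v : 'rV[K]_n) (w : 'M[K]_n) :
  v 0 i != 0 -> w \in unitmx -> set_row i (v *m w) w \in unitmx.
Proof.
move=> vi wu; rewrite set_row_mul unitmx_mul wu andbT.
by rewrite unitmxE det_set_row unitfE.
Qed.

Lemma reg_set_row p n (i : 'I_n) (v : 'rV[K]_n) :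
  (forall j, v 0 j \in reg p) -> set_row i v 1%:M \is a mxOver (reg p).
Proof.
move=> vp; apply/mxOverP => a b; rewrite mxE; case: ifP => // _.
by rewrite mxE; case: (_ == _); [exact: rpred1|exact: rpred0].
Qed.

Lemma lat_set_row p n (i : 'I_n) (v : 'rV[K]_n) (w : 'M[K]_n) :
  v 0 i != 0 -> ord p (v 0 i) = 0 -> (forall j, v 0 j \in reg p) ->
  lat p (set_row i (v *m w) w) = lat p w.
Proof.
move=> vi oi vp; rewrite set_row_mul lat_unit ?det_set_row //.
  by rewrite unitmxE det_set_row unitfE.
exact: reg_set_row.
Qed.

(** Each step of [saturate_step] lowers the order of the determinant by 1, and
    that order is bounded below by the one of h; so iterating it reaches the
    lattice of h. The index of the row to be replaced is left to the invariant
    P, which serves to control the stalks at the other points. *)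
Lemma saturate p n (h : 'M[K]_n) (P : 'M[K]_n -> Prop) : h \in unitmx ->
  (forall w (l : 'rV[k]_n), P w -> l != 0 -> exists2 i, l 0 i != 0 &
     P (set_row i (((uniformizer p)^-1 *: map_mx cst l) *m w) w)) ->
  forall w, w \in unitmx -> P w -> lat p w `<=` lat p h ->
  exists w', [/\ w' \in unitmx, P w' & lat p w' = lat p h].
Proof.
move=> hu step.
have det_le w : w \in unitmx -> lat p w `<=` lat p h ->
    ord p (\det h) <= ord p (\det w).
  move=> wu /lat_subP[T Tp Ew]; move: wu; rewrite Ew unitmx_mul => /andP[Tu _].
  have T0 : \det T != 0 by rewrite -unitfE -unitmxE.
  have h0 : \det h != 0 by rewrite -unitfE -unitmxE.
  by rewrite det_mulmx (ordM _ T0 h0) lerDr -(regE _ T0) det_reg.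
suff H (N : nat) w : w \in unitmx -> P w -> lat p w `<=` lat p h ->
    ord p (\det w) < ord p (\det h) + N%:Z ->
    exists w', [/\ w' \in unitmx, P w' & lat p w' = lat p h].
  move=> w wu Pw wh; apply: (H `|ord p (\det w) - ord p (\det h)|.+1 w) => //.
  by rewrite -addn1 PoszD addrA ltzD1 -lerBlDl abszE ler_norm.
elim: N w => [|N IH] w wu Pw wh.
  by rewrite addr0 ltNge det_le.
move=> wN; have [?|[l l0 hl]] := saturate_step wu hu wh; first by exists w.
have [i li Pw'] := step w l Pw l0.
set v := (uniformizer p)^-1 *: map_mx cst l in Pw'.
have z0 : (uniformizer p)^-1 != 0 :> K by rewrite invr_eq0 uniformizer_neq0.
have c0 : cst (l 0 i) != 0 :> K by rewrite cst_eq0.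
have vi : v 0 i = (uniformizer p)^-1 * cst (l 0 i) by rewrite !mxE.
have vi0 : v 0 i != 0 by rewrite vi mulf_neq0.
apply: IH Pw' _ _; first exact: set_row_unit.
  apply: lat_sub => a; case: (eqVneq a i) => [->|ai].
    have -> : row i (set_row i (v *m w) w) = v *m w.
      by apply/rowP => b; rewrite mxE [LHS]mxE eqxx.
    by rewrite -scalemxAl.
  have -> : row a (set_row i (v *m w) w) = row a w.
    by apply/rowP => b; rewrite mxE [LHS]mxE (negbTE ai) mxE.
  exact/wh/lat_row.
have w0 : \det w != 0 by rewrite -unitfE -unitmxE.
rewrite set_row_mul det_mulmx det_set_row (ordM _ vi0 w0) vi (ordM _ z0 c0).
rewrite ordV ?uniformizer_neq0 // ord_uniformizer ord_cst // addr0 addrC.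
by move: wN; rewrite -addn1 PoszD addrA ltzD1 => wN; rewrite ltrBlDr ltzD1.
Qed.

Lemma lat_scale p r n (f : K) (g : 'M[K]_(r, n)) :
  f != 0 -> ord p f = 0 -> lat p (f *: g) = lat p g.
Proof.
move=> f0 o0; have Ei i : row i (f *: g) = f *: row i g.
  by apply/rowP => j; rewrite !mxE.
apply/seteqP; split; apply: lat_sub => i.
  by rewrite Ei; apply: latZ; [rewrite regE // o0|exact: lat_row].
have -> : row i g = f^-1 *: row i (f *: g).
  by rewrite Ei scalerA mulVf // scale1r.
by apply: latZ; [exact: regV|exact: lat_row].
Qed.

Lemma clear_poles p n (w h : 'M[K]_n) : h \in unitmx ->
  exists N : nat, lat p (uniformizer p ^+ N *: w) `<=` lat p h.
Proof.
move=> hu; set Q := w *m invmx h.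
exists (\sum_i \sum_j `|ord p (Q i j)|)%N.
have -> : w = Q *m h by rewrite mulmxKV.
rewrite scalemxAl => v [u up ->]; rewrite mulmxA.
apply: ex_intro2 erefl; apply: mxOverM => //; apply/mxOverP => i j.
rewrite mxE; have [->|q0] := eqVneq (Q i j) 0; first by rewrite mulr0 rpred0.
set N := (\sum_i _)%N; have z0 : uniformizer p ^+ N != 0 :> K.
  by rewrite expf_neq0 ?uniformizer_neq0.
rewrite (regE _ (mulf_neq0 z0 q0)) (ordM _ z0 q0) exprnP ordX ?uniformizer_neq0
  //.
rewrite ord_uniformizer mulr1 -lerBlDr sub0r.
apply: le_trans (_ : `|ord p (Q i j)|%:Z <= _);
  first by rewrite abszE -normrN ler_norm.
rewrite lez_nat /N (bigD1 i) //= (bigD1 j) //= -addnA; exact: leq_addr.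
Qed.

(** The uniformizer X - c is a unit at the other finite points, so any row that
    occurs in the combination may be replaced. *)
Lemma saturate_finite (c : k) n (w0 h : 'M[K]_n) :
  w0 \in unitmx -> h \in unitmx ->
  exists w, [/\ w \in unitmx, lat (Some c) w = lat (Some c) h &
    forall c', c' != c -> lat (Some c') w = lat (Some c') w0].
Proof.
move=> wu hu; have [N HN] := clear_poles (Some c) w0 hu.
have o c' : c' != c -> ord (Some c') (uniformizer (Some c)) = 0.
  by move=> cc; rewrite ord_XsubC (negbTE cc).
have z0 := @uniformizer_neq0 k K (Some c).
have [|||w [wu' Pw Ew]] := @saturate (Some c) n h (fun w =>
  forall c', c' != c ->
    lat (Some c') w = lat (Some c') w0) hu _ _ _ _ HN.
- move=> w l Pw /rV0Pn[i li]; exists i => // c' cc; rewrite lat_set_row ?Pw //.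
  + by rewrite !mxE mulf_neq0 ?invr_eq0 ?cst_eq0.
  + by rewrite !mxE ordM ?invr_eq0 ?cst_eq0 // ordV // o // ord_cst.
  + by move=> j; rewrite !mxE rpredM ?reg_cst // regV ?o.
- by rewrite unitmxZ // unitfE expf_neq0.
- by move=> c' cc; rewrite lat_scale ?expf_neq0 // exprnP ordX // o // mulr0.
- by exists w.
Qed.

(** A local frame fails to generate at finitely many points only; these are
    repaired one by one. This is the freeness of projective k[x]-modules. *)
Lemma finite_frame n (E : closed_point k -> set 'rV[K]_n) :
  (forall p, exists (g : 'M[K]_n) (s : seq (closed_point k)),
    [/\ g \in unitmx, p \notin s & forall q, q \notin s -> E q = lat q g]) ->
  exists2 g, g \in unitmx & forall c, E (Some c) = lat (Some c) g.
Proof.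
move=> HE; have [g0 [s [gu _ Hg]]] := HE None.
suff: exists2 g, g \in unitmx & forall c, Some c \notin [::] -> E (Some c) =
  lat (Some c) g.
  by case=> g gu' Eg; exists g => // c; exact: Eg.
have {Hg} : exists2 g, g \in unitmx & forall c, Some c \notin s -> E (Some c) =
  lat (Some c) g.
  by exists g0 => // c; exact: Hg.
elim: s => // p s IH [g {}gu Hg]; apply: IH; case: p Hg => [c|] Hg; last first.
  by exists g => // c cs; apply: Hg; rewrite inE.
have [h [s' [hu cs' Eh]]] := HE (Some c).
have [w [wu wc w0]] := saturate_finite c gu hu.
exists w => // c' c's; case: (eqVneq c' c) => [->|cc]; first by rewrite wc Eh.
rewrite w0 // Hg // inE negb_or c's andbT.
by apply: contra_neq cc => -[].
Qed.

(** Passing from O to O(m) multiplies the stalk at infinity by x^m. *)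
Definition twist_factor p (m : int) : K := if p is Some _ then 1 else ratX ^ m.

Definition twist_mx p r (a : 'I_r -> int) : 'M[K]_r :=
  diag_mx (\row_i twist_factor p (a i)).

Definition twist p r n (a : 'I_r -> int) (g : 'M[K]_(r, n)) : 'M[K]_(r, n) :=
  \matrix_(i, j) (twist_factor p (a i) * g i j).

Lemma twist_factor_neq0 p m : twist_factor p m != 0.
Proof. by case: p => [c|] /=; rewrite ?oner_eq0 ?expfz_neq0 ?ratX_neq0. Qed.

Lemma twist_Some c r n (a : 'I_r -> int) (g : 'M[K]_(r, n)) :
  twist (Some c) a g = g.
Proof. by apply/matrixP => i j; rewrite mxE mul1r. Qed.

Lemma twistK p r n (a : 'I_r -> int) (g : 'M[K]_(r, n)) :
  twist p (fun i => - a i) (twist p a g) = g.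
Proof.
apply/matrixP => i j; rewrite !mxE mulrA; case: p => [c|] /=;
  first by rewrite !mul1r.
by rewrite -expfzDr ?ratX_neq0 // addNr mul1r.
Qed.

Lemma twistE p r n (a : 'I_r -> int) (g : 'M[K]_(r, n)) :
  twist p a g = twist_mx p a *m g.
Proof. by rewrite mul_diag_mx; apply/matrixP => i j; rewrite !mxE. Qed.

Lemma twist_mx_unit p r (a : 'I_r -> int) : twist_mx p a \in unitmx.
Proof.
rewrite unitmxE det_diag unitfE; apply/prodf_neq0 => i _.
by rewrite mxE twist_factor_neq0.
Qed.

Lemma twist_unit p r (a : 'I_r -> int) (g : 'M[K]_r) :
  g \in unitmx -> twist p a g \in unitmx.
Proof. by move=> gu; rewrite twistE unitmx_mul twist_mx_unit. Qed.

(** The Birkhoff-Grothendieck theorem. The basis w that is saturated at infinity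
    spans the finite stalks only after its i-th vector has been multiplied by
    x^(a i). *)
Lemma splitting n (E : closed_point k -> set 'rV[K]_n) :
  (forall p, exists (g : 'M[K]_n) (s : seq (closed_point k)),
    [/\ g \in unitmx, p \notin s & forall q, q \notin s -> E q = lat q g]) ->
  exists (g : 'M[K]_n) (a : 'I_n -> int),
    g \in unitmx /\ forall p, E p = lat p (twist p a g).
Proof.
move=> HE; have [g gu Hg] := finite_frame HE.
have [h [s [hu ns Eh]]] := HE None.
have [N HN] := clear_poles None g hu.
pose P w := exists a : 'I_n -> int,
  forall c, lat (Some c) (twist None a w) = E (Some c).
have [|||w [wu [a Pw] Ew]] := @saturate None n h P hu _ _ _ _ HN.
- move=> w l [a Pw] /rV0Pn[i0 li0].
  (* the largest exponent makes all the coefficients below polynomial *)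
  pose i := [arg max_(i > i0 | l 0 i != 0) a i]%O.
  have [li imax] : l 0 i != 0 /\ forall j, l 0 j != 0 -> a j <= a i.
    by rewrite /i; case: Order.TotalTheory.arg_maxP.
  exists i => //; exists (fun j => if j == i then a i - 1 else a j) => c.
  pose v : 'rV[K]_n := \row_j (cst (l 0 j) * ratX ^ (a i - a j)).
  have vi : v 0 i = cst (l 0 i) by rewrite mxE subrr expr0z mulr1.
  rewrite -Pw -[RHS](@lat_set_row _ _ i v) ?vi ?cst_eq0 ?ord_cst //; last first.
    move=> j; rewrite mxE; have [->|lj] := eqVneq (l 0 j) 0.
      by rewrite rmorph0 mul0r rpred0.
    rewrite rpredM ?reg_cst //; have := imax _ lj; rewrite -subr_ge0.
    by case: (a i - a j) => // m _; rewrite -exprnP rpredX // reg_poly.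
  congr lat; apply/matrixP => x y; rewrite !mxE; case: ifP => // _.
  rewrite /= invrK !mulr_sumr; apply: eq_bigr => j _; rewrite !mxE.
  have e m : ratX ^ (m - 1) * ratX = ratX ^ m :> K.
    by rewrite -[X in _ * X]expr1z -expfzDr ?ratX_neq0 // subrK.
  rewrite !mulrA e -[_ * _ * ratX ^ a j]mulrA -expfzDr ?ratX_neq0 // subrK.
  by rewrite [ratX ^ _ * _]mulrC.
- by rewrite unitmxZ // unitfE expf_neq0 ?uniformizer_neq0.
- exists (fun _ => N%:Z) => c; rewrite Hg; congr lat; apply/matrixP => x y.
  rewrite !mxE /= exprVn mulrA -exprnP divff ?mul1r //.
  by rewrite expf_neq0 ?ratX_neq0.
exists (twist None a w), (fun i => - a i); split; first exact: twist_unit.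
case=> [c|]; first by rewrite twist_Some -Pw.
by rewrite twistK Ew Eh.
Qed.

End Splitting.

(** * Degrees *)

Section Degree.
Context {k : closedFieldType} {K : ratField k}.
Implicit Types (p : closed_point k).
Local Notation ord := (@ordf k K).

(** The degree of the line bundle generated by f p at each point p. *)
Definition divisor_degree (f : closed_point k -> K) (e : int) : Prop :=
  exists s : seq (closed_point k), [/\ uniq s,
    forall p, p \notin s -> ord p (f p) = 0
    & e = \sum_(p <- s) - ord p (f p)].

Lemma sum_support (s S : seq (closed_point k)) (F : closed_point k -> int) :
  uniq s -> uniq S -> {subset s <= S} -> (forall p, p \notin s -> F p = 0) ->
  \sum_(p <- s) F p = \sum_(p <- S) F p.
Proof.
move=> us uS sS F0; rewrite [RHS](bigID (fun p => p \in s)) /=.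
rewrite [X in _ + X]big1 ?addr0 => [|p]; last exact: F0.
rewrite -[RHS]big_filter; apply: perm_big; apply: uniq_perm => //.
  exact: filter_uniq.
by move=> p; rewrite mem_filter; case ps: (p \in s) => //=; rewrite sS.
Qed.

(** The determinant of the base change between the two local frames is regular
    at every point, and the divisors of det B and det B' have degree 0. *)
Lemma degree_le r (B B' : 'M[K]_r) (h h' : closed_point k -> 'M[K]_r) e e' :
  B \in unitmx -> B' \in unitmx ->
  (forall p, h p \in unitmx) -> (forall p, h' p \in unitmx) ->
  (forall p, lat p (h p *m B) `<=` lat p (h' p *m B')) ->
  divisor_degree (fun p => \det (h p)) e ->
  divisor_degree (fun p => \det (h' p)) e' -> e <= e'.
Proof.
move=> Bu B'u hu h'u hh' [s [us hs ->]] [s' [us' hs' ->]].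
have nz (A : 'M[K]_r) : A \in unitmx -> \det A != 0 by rewrite unitmxE unitfE.
have [t Ht] := principal_divisor (nz _ Bu).
have [t' Ht'] := principal_divisor (nz _ B'u).
pose S := undup (s ++ s' ++ t ++ t').
have uS : uniq S by exact: undup_uniq.
have sub u : u \in [:: s; s'; t; t'] -> {subset u <= S}.
  rewrite !inE => /or4P[] /eqP-> p ps; rewrite mem_undup !mem_cat ps ?orbT //.
rewrite (@sum_support s S) //; [|by apply: sub; rewrite !inE eqxx ?orbT|
  by move=> p ps; rewrite hs ?oppr0].
rewrite (@sum_support s' S) //; [|by apply: sub; rewrite !inE eqxx ?orbT|
  by move=> p ps; rewrite hs' ?oppr0].
have eB : \sum_(p <- S) ord p (\det B) = 0.
  by apply: Ht => //; apply: sub; rewrite !inE eqxx ?orbT.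
have eB' : \sum_(p <- S) ord p (\det B') = 0.
  by apply: Ht' => //; apply: sub; rewrite !inE eqxx ?orbT.
rewrite !sumrN lerN2.
suff : \sum_(p <- S) (ord p (\det (h' p)) + ord p (\det B')) <=
       \sum_(p <- S) (ord p (\det (h p)) + ord p (\det B)).
  by rewrite !big_split /= eB eB' !addr0.
apply: ler_sum => p _.
rewrite -(ordM _ (nz _ (h'u p)) (nz _ B'u)) -(ordM _ (nz _ (hu p)) (nz _ Bu)).
rewrite -!det_mulmx; have [T Tp E] := lat_subP (hh' p).
have Tu : T \in unitmx.
  have : T *m (h' p *m B') \in unitmx by rewrite -E unitmx_mul hu.
  by rewrite unitmx_mul => /andP[].
have h'B : \det (h' p *m B') != 0 by rewrite nz // unitmx_mul h'u.
rewrite E (det_mulmx T) (ordM _ (nz _ Tu) h'B) lerDr -(regE _ (nz _ Tu)).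
exact: det_reg.
Qed.

Lemma ord_twist_factor p m : ord p (twist_factor p m) =
  if p is None then - m else 0.
Proof.
by case: p => [c|] /=; rewrite ?ord_1 // ordX ?ratX_neq0 // ord_ratX mulrN1.
Qed.

Lemma twist_degree r (a : 'I_r -> int) :
  divisor_degree (fun p => \det (twist_mx p a)) (\sum_i a i).
Proof.
have od p : ord p (\det (twist_mx p a)) = if p is None then - \sum_i a i else 0.
  rewrite det_diag.
  have -> : \prod_i (\row_i twist_factor p (a i)) 0 i =
    twist_factor p (\sum_i a i) :> K.
    case: p => [c|] /=; first by rewrite big1 // => i _; rewrite mxE.
    elim/big_rec2: _ => [|i x y _ ->]; first by rewrite expr0z.
    by rewrite mxE -expfzDr ?ratX_neq0.
  by rewrite ord_twist_factor.
exists [:: None]; split=> //; last by rewrite big_seq1 od opprK.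
by case=> // c _; rewrite od.
Qed.

Lemma lat_twistP p n (a : 'I_n -> int) (g : 'M[K]_n) v : g \in unitmx ->
  lat p (twist p a g) v <->
  forall i, (v *m invmx g) 0 i / twist_factor p (a i) \in reg p.
Proof.
move=> gu; rewrite twistE; split=> [[u up ->] i|H].
  rewrite mulmxA mulmxK // mul_mx_diag !mxE mulfK ?twist_factor_neq0 //.
  exact: (mxOverP up).
exists (\row_i ((v *m invmx g) 0 i / twist_factor p (a i))).
  by apply/mxOverP => x y; rewrite mxE.
rewrite mulmxA -[LHS](mulmxKV gu); congr (_ *m _).
by apply/rowP => i; rewrite mul_mx_diag !mxE divfK ?twist_factor_neq0.
Qed.

Lemma reg_twist_factor p m : m <= 0 -> (twist_factor p m : K) \in reg p.
Proof.
by move=> m0; rewrite regE ?twist_factor_neq0 // ord_twist_factor;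
  case: p => //; rewrite oppr_ge0.
Qed.

(** Some r columns of B are linearly independent; projecting to them embeds the
    subsheaf in the sum of r copies of O(m). *)
Lemma subsheaf_degree_le r n (B : 'M[K]_(r, n)) (h : closed_point k -> 'M[K]_r)
    (a : 'I_n -> int) (m e : int) :
  row_free B -> (forall p, h p \in unitmx) ->
  (forall p, lat p (h p *m B) `<=` lat p (twist p a 1%:M)) ->
  (forall i, a i <= m) -> divisor_degree (fun p => \det (h p)) e ->
  e <= r%:Z * m.
Proof.
move=> Bf hu hB am he.
have fB : row_full B^T by rewrite /row_full mxrank_tr.
pose P := (rowsub (fullrankfun fB) (1%:M : 'M[K]_n))^T.
have BPu : B *m P \in unitmx.
  rewrite -unitmx_tr trmx_mul trmxK -rowsubE -row_full_unit.
  exact: fullrowsub_full.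
have P01 p : P \is a mxOver (reg p).
  apply/mxOverP => i j; rewrite !mxE.
  by case: (_ == _); [exact: rpred1|exact: rpred0].
have := degree_le (h := h) (h' := fun p => twist_mx p (fun=> m)) BPu
  (unitmx1 _ _) hu (fun p => twist_mx_unit p _) _ he (twist_degree _).
rewrite sumr_const card_ord -mulr_natl natz; apply=> p.
apply: lat_sub => i; rewrite -twistE.
have : lat p (twist p a 1%:M) (row i (h p *m B)) by apply/hB/lat_row.
move=> /(lat_twistP _ _ _ (unitmx1 _ _)) H.
apply/lat_twistP; rewrite ?unitmx1 // => j.
rewrite mulmxA row_mul invmx1 mulmx1 mxE mulr_suml; apply: rpred_sum => l _.
rewrite mulrAC rpredM ?(mxOverP (P01 p)) //.
have := H l; rewrite invmx1 mulmx1 => Hl.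
have -> : row i (h p *m B) 0 l / twist_factor p m =
  row i (h p *m B) 0 l / twist_factor p (a l) * twist_factor p (a l - m).
  rewrite -[LHS]mulr1 -!mulrA; congr (_ * _); case: (p) => [c|] /=.
    by rewrite !mulr1.
  by rewrite mulr1 expfzDr ?ratX_neq0 // mulKf ?expfz_neq0 ?ratX_neq0 //
    invr_expz.
by rewrite rpredM // reg_twist_factor // subr_le0.
Qed.

(** The twisted frame at p generates away from these points: x is a unit except
    at 0 and infinity. *)
Definition chart_complement p : seq (closed_point k) :=
  if p is Some _ then [:: None] else [:: Some 0].

Lemma chart_self p : p \notin chart_complement p.
Proof. by case: p. Qed.

Lemma twist_frame p q r n (a : 'I_r -> int) (g : 'M[K]_(r, n)) :
  q \notin chart_complement p -> lat q (twist q a g) = lat q (twist p a g).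
Proof.
case: p => [c'|]; case: q => [c|] // c0.
have c_neq0 : c != 0 by apply: contraNneq c0 => ->; rewrite inE.
have ox : ord (Some c) ratX = 0 by rewrite ord_ratX (negbTE c_neq0).
have ot m : ord (Some c) (twist_factor None m) = 0.
  by rewrite /= ordX ?ratX_neq0 // ox mulr0.
rewrite twist_Some twistE lat_unit //.
- exact: twist_mx_unit.
- apply/mxOverP => i j; rewrite !mxE; case: (_ == _);
  rewrite ?mulr0n ?rpred0 //.
  by rewrite mulr1n regE ?twist_factor_neq0 // ot.
- rewrite det_diag.
  apply: (big_ind (fun f : K => f != 0 /\ ord (Some c) f = 0) _ _ _).2 =>
    [|f f'|i _].
  + by rewrite oner_eq0 ord_1.
  + by move=> [f0 o] [f'0 o']; rewrite mulf_neq0 // ordM // o o'.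
  + by rewrite mxE twist_factor_neq0 ot.
Qed.

Lemma lat_col_row' p n (G : 'M[K]_(n.+1)) j :
  lat p (col_mx (row' j G) (row j G)) = lat p G.
Proof.
have E i : row i (row' j G) = row (lift j i) G by apply/rowP => ?; rewrite !mxE.
apply/seteqP; split; apply: lat_sub => i.
  case: (split_ordP i) => l ->.
    by rewrite rowKu E; exact: lat_row.
  rewrite rowKd; have -> : row l (row j G) = row j G by apply/rowP => ?;
    rewrite !mxE.
  exact: lat_row.
case: (unliftP j i) => [l|] ->.
  rewrite -E -(rowKu l (row' j G) (row j G)); exact: lat_row.
have e : row (rshift n 0) (col_mx (row' j G) (row j G)) = row j G.
  by rewrite rowKd; apply/rowP => ?; rewrite !mxE.
by rewrite -[X in lat _ _ X]e; exact: lat_row.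
Qed.

Lemma row_free_col_row' n (G : 'M[K]_(n.+1)) j : G \in unitmx ->
  row_free (col_mx (row' j G) (row j G)).
Proof.
rewrite -row_free_unit => Gf.
have sub : (G <= col_mx (row' j G) (row j G))%MS.
  apply/row_subP => i; rewrite -addsmxE; case: (unliftP j i) => [l|] ->.
    apply: submx_trans (addsmxSl _ _).
    have -> : row (lift j l) G = row l (row' j G) by apply/rowP => ?;
      rewrite !mxE.
    exact: row_sub.
  exact: addsmxSr.
by rewrite -row_leq_rank (leq_trans _ (mxrankS sub)) // (eqP Gf) addn1.
Qed.

End Degree.

(** * Spaces of sections *)

Section LinearSections.
Context {k : closedFieldType} {K : ratField k}.
Implicit Types (p : closed_point k).
Local Notation ord := (@ordf k K).

Definition linear_sections (n : nat) : 'M[K]_(n.+1, n) :=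
  \matrix_(i, j) (if i == j :> nat then ratX
                   else if i == j.+1 :> nat then -1 else 0).

Lemma linear_sections_ker n (y : 'rV[K]_n.+1) : y *m linear_sections n = 0 ->
  forall i, y 0 i = y 0 0 * ratX ^+ i.
Proof.
move=> y0 [i]; elim: i => [|i IH] iP /=.
  by rewrite expr0 mulr1; congr (y 0 _); exact: val_inj.
have lt_in : (i < n)%N by [].
have := congr1 (fun M : 'M_(_, _) => M 0 (Ordinal lt_in)) y0.
rewrite !mxE (bigD1 (Ordinal (ltnW iP : (i < n.+1)%N))) //=.
rewrite (bigD1 (Ordinal iP)) /=; last by rewrite -val_eqE /= gtn_eqF.
rewrite big1 ?addr0 => [|[l lP]]; last first.
  rewrite -!val_eqE /= => /andP[li li1]; rewrite mxE /=.
  by rewrite (negbTE li) (negbTE li1) mulr0.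
rewrite !mxE /= !eqxx gtn_eqF // mulrN1 => /eqP; rewrite subr_eq0 => /eqP <-.
by rewrite IH exprSr mulrA.
Qed.

Lemma ratX_free n (b : 'I_n -> k) :
  \sum_i cst (b i) * ratX ^+ i = 0 :> K -> forall i, b i = 0.
Proof.
have -> : \sum_i cst (b i) * ratX ^+ i = emb K (\sum_(i < n) b i *: 'X^i).
  rewrite rmorph_sum; apply: eq_bigr => i _.
  by rewrite -mul_polyC rmorphM rmorphXn.
move=> /eqP; rewrite emb_eq0 => /eqP b0 i.
have := congr1 (fun q : {poly k} => q`_i) b0; rewrite coef0 coef_sum.
rewrite (bigD1 i) //= coefZ coefXn eqxx mulr1 big1 ?addr0 // => j ji.
by rewrite coefZ coefXn eq_sym (inj_eq val_inj) (negbTE ji) mulr0.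
Qed.

Lemma linear_sections_inj n (c : 'rV[k]_n.+1) : (0 < n)%N ->
  map_mx cst c *m linear_sections n = 0 -> c = 0.
Proof.
case: n c => // n c _ /linear_sections_ker H.
have c0 : c 0 0 = 0.
  have := H (lift ord0 ord0); rewrite !mxE expr1 => e.
  apply/eqP; apply: contraT => b0.
  have cb0 : cst (c 0 0) != 0 :> K by rewrite cst_eq0.
  have a0 : c 0 (lift ord0 ord0) != 0.
    by rewrite -(cst_eq0 (K := K)) e mulf_neq0 ?ratX_neq0.
  have : ord (Some 0) (cst (c 0 0) * ratX) = 1.
    by rewrite (ordM _ cb0 ratX_neq0) ord_cst // ord_ratX eqxx.
  by rewrite -e ord_cst.
apply/rowP => i; rewrite [RHS]mxE; apply/eqP; rewrite -(cst_eq0 (K := K)).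
by have := H i; rewrite !mxE c0 rmorph0 mul0r => ->.
Qed.

(** If the combinations with coefficients C satisfy a relation over k(x), then
    (1, x, ..., x^n) lies in the row space of C over k(x). By independence of
    the powers of x over k, no nonzero constant column is killed by C, so that
    C has full rank n+1. *)
Lemma linear_sections_rank n m (C : 'M[k]_(m, n.+1)) : row_free C ->
  row_free (map_mx cst C *m linear_sections n) \/
  \rank (map_mx cst C *m linear_sections n) = n.
Proof.
move=> Cf; have [|nf] := boolP (row_free _); first by left.
right; move: nf; rewrite -kermx_eq0 => /rowV0Pn[rho /sub_kermxP rw rho0].
pose y := rho *m map_mx cst C.
have y0 : y != 0.
  apply: contra_neq rho0 => yE.
  have Cf' : row_free (map_mx (cst : k -> K) C) by rewrite row_free_map.
  by apply: (row_free_inj Cf'); rewrite mul0mx.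
have yE := linear_sections_ker (y := y).
rewrite /y -mulmxA rw in yE; have {}yE := yE erefl.
have y00 : y 0 0 != 0.
  apply: contra_neq y0 => e; apply/rowP => i.
  by rewrite yE -/y e mul0r mxE.
have Cfull : row_full C.
  rewrite -cokermx_eq0; apply/eqP/matrixP => i j; rewrite [RHS]mxE.
  apply: (@ratX_free n.+1 (fun i => cokermx C i j)); apply: (mulfI y00).
  have : y *m map_mx cst (cokermx C) = 0.
    by rewrite -mulmxA -map_mxM mulmx_coker map_mx0 mulmx0.
  move=> /matrixP/(_ 0 j); rewrite [RHS]mxE [LHS]mxE => h.
  rewrite mulr0 -[RHS]h mulr_sumr; apply: eq_bigr => l _.
  by rewrite [y 0 l]yE -/y [map_mx _ _ _ _]mxE -mulrA [X in _ = _ * X]mulrC.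
rewrite eqmxMfull ?row_full_map //.
apply/eqP; rewrite eqn_leq rank_leq_col.
pose u : 'rV[K]_n.+1 := \row_i ratX ^+ i.
have : (kermx (linear_sections n) <= u)%MS.
  apply/row_subP => i;
    have : row i (kermx (linear_sections n)) *m linear_sections n = 0.
    by apply/sub_kermxP/row_sub.
  move=> /linear_sections_ker H.
  have -> : row i (kermx (linear_sections n)) =
    row i (kermx (linear_sections n)) 0 0 *: u.
    by apply/rowP => j; rewrite H [RHS]mxE [u _ _]mxE.
  by rewrite scalemx_sub.
move=> /mxrankS; rewrite mxrank_ker => h.
have : (n.+1 - \rank (linear_sections n) <= 1)%N by apply: leq_trans h
  (rank_leq_row _).
by rewrite leq_subLR addn1 ltnS.
Qed.

Lemma linear_sections_regular p n (a : 'I_n -> int) i :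
  (forall j, 1 <= a j) ->
  lat p (twist p a 1%:M) (row i (linear_sections n)).
Proof.
move=> a1; apply/lat_twistP; rewrite ?unitmx1 // => j.
rewrite invmx1 mulmx1 !mxE.
have t0 : (twist_factor p (a j) : K)^-1 \in reg p.
  rewrite regE ?invr_eq0 ?twist_factor_neq0 // ordV ?twist_factor_neq0 //
    ord_twist_factor.
  by case: (p) => //; rewrite opprK; exact: le_trans (a1 j).
case: ifP => _; last by case: ifP => _; rewrite rpredM ?rpred0 ?rpredN ?rpred1.
rewrite regE ?mulf_neq0 ?invr_eq0 ?twist_factor_neq0 ?ratX_neq0 //.
rewrite ordM ?invr_eq0 ?twist_factor_neq0 ?ratX_neq0 // ordV ?twist_factor_neq0
  // ord_twist_factor ord_ratX.
by case: (p) => [c|]; rewrite ?subr0 // opprK addrC subr_ge0.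
Qed.

(** A coordinate in a summand of degree at most 0 is regular everywhere. *)
Lemma coordinate_constant n m (g : 'M[K]_n) (a : 'I_n -> int)
    (w : 'M[K]_(m, n)) j : g \in unitmx -> a j <= 0 ->
  (forall p i, lat p (twist p a g) (row i w)) ->
  exists eta : 'cV[k]_m, col j (w *m invmx g) = map_mx cst eta.
Proof.
move=> gu aj wg; have /choice[eta Heta] :
    forall i, exists c, (w *m invmx g) i j = cst c.
  move=> i; apply: global_regular => p.
  have := (lat_twistP p a _ gu).1 (wg p i) j; rewrite -row_mul mxE => H.
  rewrite -[_ i j](divfK (twist_factor_neq0 p (a j))) rpredM //
    reg_twist_factor //.
by exists (\col_i eta i); apply/colP => i; rewrite !mxE -Heta !mxE.
Qed.

End LinearSections.

(** * Bundles on the projective line *)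

Lemma tofrac_fracP (k : closedFieldType) (f : ratfun k) :
  exists a b : {poly k}, b != 0 /\ f = tofrac a / tofrac b.
Proof.
exists \n_(repr f), \d_(repr f); set u := repr f.
have d0 : \d_u != 0 by exact: denom_ratioP.
split=> //; rewrite -[LHS](mulfK (_ : tofrac \d_u != 0)) ?tofrac_eq0 //.
congr (_ / _); rewrite -[f]reprK -/u; unlock tofrac.
rewrite -[LHS]FracField.pi_mul; apply/eqmodP.
rewrite /= FracField.equivfE /FracField.mulf.
by rewrite !numden_Ratio ?mulf_neq0 ?oner_eq0 // !mulr1 mulrC.
Qed.

Definition ratfunField (k : closedFieldType) : ratField k :=
  @RatField k (ratfun k) (@tofrac {poly k}) (@ord k) (@tofrac_eq0 _)
    (@tofrac_fracP k) (@ord_quotient k).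

Section Bridge.
Context {k : closedFieldType}.
Implicit Types (p : closed_point k).
Local Notation K := (ratfunField k).

Lemma latticeE p r n (g : 'M[K]_(r, n)) : @lattice k p r n g = lat p g.
Proof.
apply/seteqP; split=> v.
  move=> [u [up ->]]; exists u => //; apply/mxOverP => i j; rewrite (ord1 i).
  by apply/orP; case: (up j) => [->|?]; [left; rewrite eqxx|right].
move=> [u up ->]; exists u; split=> // j.
by have /orP[/eqP ?|?] := mxOverP up 0 j; [left|right].
Qed.

Lemma vector_bundleE n r (E : stalks k n) : vector_bundle r E <->
  forall p, exists (g : 'M[K]_(r, n)) (s : seq (closed_point k)),
    [/\ row_free g, p \notin s & forall q, q \notin s -> E q = lat q g].
Proof.
split=> H p; have [g [s [gf ps Eg]]] := H p; exists g, s; split=> // q qs.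
  by rewrite (Eg q qs) -latticeE.
by rewrite (Eg q qs) latticeE.
Qed.

Lemma subbundleE n r (F E : stalks k n) : subbundle r F E <->
  forall p, exists (m : nat) (g : 'M[K]_(r, n)) (g' : 'M[K]_(m, n))
      (s : seq (closed_point k)),
    [/\ row_free (col_mx g g'), p \notin s
      & forall q, q \notin s -> F q = lat q g /\ E q = lat q (col_mx g g')].
Proof.
split=> H p; have [m [g [g' [s [gf ps Eg]]]]] := H p; exists m, g, g', s;
  split=> // q qs; have [-> ->] := Eg q qs.
  by rewrite -!latticeE.
by rewrite !latticeE.
Qed.

Lemma has_degreeE n r (E : stalks k n) d : has_degree r E d <->
  exists (B : 'M[K]_(r, n)) (h : closed_point k -> 'M[K]_r),
    [/\ row_free B, forall p, h p \in unitmx,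
        forall p, E p = lat p (h p *m B)
      & divisor_degree (fun p => \det (h p)) d].
Proof.
split.
  move=> [B [h [s [Bf hE us hs dE]]]]; exists B, h; split=> //.
  - by move=> p; have [] := hE p.
  - by move=> p; have [_ ->] := hE p; rewrite -latticeE.
  - by exists s.
move=> [B [h [Bf hu hE [s [us hs dE]]]]]; exists B, h, s; split=> // p.
by split; [exact: hu|rewrite hE latticeE].
Qed.
End Bridge.

Section SplitBundles.
Context {k : closedFieldType}.
Implicit Types (p : closed_point k).
Local Notation K := (ratfunField k).

(** The direct sum of the O(a i), embedded in the generic stalk by the rows of
    g. *)
Definition split_bundle r n (a : 'I_r -> int) (g : 'M[K]_(r, n)) : stalks k n :=
  fun p => lat p (twist p a g).

Lemma twist_free p r n (a : 'I_r -> int) (g : 'M[K]_(r, n)) :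
  row_free g -> row_free (twist p a g).
Proof.
by move=> gf; rewrite twistE /row_free mxrankMfree // -/(row_free _)
  row_free_unit twist_mx_unit.
Qed.

Lemma split_vector_bundle r n (a : 'I_r -> int) (g : 'M[K]_(r, n)) :
  row_free g -> vector_bundle r (split_bundle a g).
Proof.
move=> gf; apply/vector_bundleE => p;
  exists (twist p a g), (chart_complement p).
split; [exact: twist_free|exact: chart_self|].
by move=> q qs; exact: (twist_frame a g qs).
Qed.

Lemma split_has_degree r n (a : 'I_r -> int) (g : 'M[K]_(r, n)) :
  row_free g -> has_degree r (split_bundle a g) (\sum_i a i).
Proof.
move=> gf; apply/has_degreeE; exists g, (fun p => twist_mx p a); split.
- exact: gf.
- by move=> p; exact: twist_mx_unit.
- by move=> p; rewrite /split_bundle twistE.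
- exact: twist_degree.
Qed.

Lemma vector_bundle_split n (E : stalks k n) : vector_bundle n E ->
  exists (a : 'I_n -> int) (g : 'M[K]_n), g \in unitmx /\ E = split_bundle a g.
Proof.
move=> /vector_bundleE HE; have [|g [a [gu Eg]]] := @splitting k K n E.
  move=> p; have [g [s [gf ps Eg]]] := HE p; exists g, s; split=> //.
  by rewrite -row_free_unit.
by exists a, g; split=> //; apply/funext => p; exact: Eg.
Qed.

Lemma has_degree_le n (F E : stalks k n) e d :
  (forall p, F p `<=` E p) -> has_degree n F e -> has_degree n E d -> e <= d.
Proof.
move=> FE /has_degreeE[B [h [Bf hu hF he]]] /has_degreeE[B' [h' [B'f h'u hE
  hd]]].
apply: (degree_le (K := K) (B := B) (B' := B') _ _ hu h'u _ he hd).
- by rewrite -row_free_unit.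
- by rewrite -row_free_unit.
- by move=> p; rewrite -hF -hE; exact: FE.
Qed.

Lemma has_degree_unique n (E : stalks k n) e d :
  has_degree n E e -> has_degree n E d -> e = d.
Proof.
move=> he hd; have EE p : E p `<=` E p by [].
by apply/eqP; rewrite eq_le (has_degree_le EE he hd) (has_degree_le EE hd he).
Qed.

Lemma subbundle_refl n r (E : stalks k n) : vector_bundle r E ->
  subbundle r E E.
Proof.
move=> /vector_bundleE HE; apply/subbundleE => p.
have [g [s [gf ps Eg]]] := HE p; exists 0, g, (0 : 'M[K]_(0, n)), s.
have sub : (g <= col_mx g (0 : 'M[K]_(0, n)))%MS.
  by rewrite -addsmxE addsmxSl.
have E0 q : lat q (col_mx g (0 : 'M[K]_(0, n))) = lat q g.
  apply/seteqP; split; apply: (lat_sub (K := K)) => i.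
    by case: (split_ordP i) => l -> //; [rewrite rowKu; exact: lat_row|case: l].
  by rewrite -(rowKu i g (0 : 'M[K]_(0, n))); exact: lat_row.
split=> //; last by move=> q qs; rewrite E0 Eg.
rewrite -row_leq_rank; apply: leq_trans (mxrankS sub).
by rewrite (eqP gf) addn0.
Qed.

Lemma subbundle_sub n r (F E : stalks k n) : subbundle r F E ->
  forall p, F p `<=` E p.
Proof.
move=> /subbundleE H p; have [m [g [g' [s [_ ps Eg]]]]] := H p.
have [-> ->] := Eg p ps; apply: (lat_sub (K := K)) => i.
by rewrite -(rowKu i g g'); exact: lat_row.
Qed.

Lemma subbundle_rank n r (F E : stalks k n) : subbundle r F E -> (r <= n)%N.
Proof.
move=> /subbundleE H; have [m [g [g' [s [gf _ _]]]]] := H None.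
have : (r + m <= n)%N by rewrite -(eqP gf) rank_leq_col.
by apply: leq_trans; exact: leq_addr.
Qed.

(** A complement of rank 0 leaves nothing to extend. *)
Lemma subbundle_full n (F E : stalks k n) : subbundle n F E -> F = E.
Proof.
move=> /subbundleE H; apply/funext => p.
have [m [g [g' [s [gf ps Eg]]]]] := H p.
have m0 : m = 0%N.
  have : (n + m <= n)%N by rewrite -(eqP gf) rank_leq_col.
  by rewrite -{2}[n]addn0 leq_add2l leqn0 => /eqP.
move: g' gf Eg; rewrite m0 => g' gf Eg; have [-> ->] := Eg p ps.
apply/seteqP; split; apply: (lat_sub (K := K)) => i.
  by rewrite -(rowKu i g g'); exact: lat_row.
by case: (split_ordP i) => l -> //; [rewrite rowKu; exact: lat_row|case: l].
Qed.

Lemma split_subbundle_row' n (a : 'I_n.+1 -> int) (g : 'M[K]_n.+1) j :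
  g \in unitmx ->
  subbundle n (split_bundle (a \o lift j) (row' j g)) (split_bundle a g).
Proof.
move=> gu; apply/subbundleE => p.
exists 1%N, (row' j (twist p a g)), (row j (twist p a g)), (chart_complement p).
have tr : row' j (twist p a g) = twist p (a \o lift j) (row' j g).
  by apply/matrixP => x y; rewrite !mxE.
split.
- by apply: row_free_col_row'; exact: twist_unit.
- exact: chart_self.
move=> q qs; rewrite lat_col_row'; split; last exact: (twist_frame a g qs).
by rewrite tr; exact: (@twist_frame k K p q n n.+1 (a \o lift j) (row' j g) qs).
Qed.

Lemma subbundle_degree_le r n (F : stalks k n) (a : 'I_n -> int) (m e : int) :
  has_degree r F e -> (forall p, F p `<=` split_bundle a 1%:M p) ->
  (forall i, a i <= m) -> e <= r%:Z * m.
Proof.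
move=> /has_degreeE[B [h [Bf hu hF he]]] FE am.
by apply: (subsheaf_degree_le Bf hu _ am he) => p; rewrite -hF; exact: FE.
Qed.

Lemma has_degree_rank r n m (F : stalks k n) e (w : 'M[K]_(m, n)) :
  has_degree r F e -> (forall i, F None (row i w)) -> (\rank w <= r)%N.
Proof.
move=> /has_degreeE[B [h [Bf hu hF he]]] wF.
have : (w <= B)%MS.
  apply/row_subP => i; have := wF i; rewrite hF => -[u _ ->].
  by rewrite mulmxA submxMl.
by move=> /mxrankS /leq_trans; apply; exact: rank_leq_row.
Qed.

Definition comb m n (w : 'M[K]_(m, n)) (c : 'rV[k]_m) : 'rV[K]_n :=
  map_mx cst c *m w.

Lemma subspace_of_dimE n (V : set 'rV[K]_n) m :
  @subspace_of_dim k n V m <->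
  exists w : 'M[K]_(m, n), injective (comb w) /\ V = range (comb w).
Proof. by []. Qed.

Lemma comb_inj m n (w : 'M[K]_(m, n)) :
  (forall c, comb w c = 0 -> c = 0) -> injective (comb w).
Proof.
move=> w0 c c' /eqP; rewrite -subr_eq0 -mulmxBl -map_mxB => /eqP/w0/eqP.
by rewrite subr_eq0 => /eqP.
Qed.

Lemma comb_delta m n (w : 'M[K]_(m, n)) i : comb w (delta_mx 0 i) = row i w.
Proof. by rewrite /comb map_delta_mx -rowE. Qed.

Lemma comb_mul m m' n (C : 'M[k]_(m', m)) (w : 'M[K]_(m, n)) c :
  comb (map_mx cst C *m w) c = comb w (c *m C).
Proof. by rewrite /comb map_mxM mulmxA. Qed.

Lemma sub_range_comb m m' n (w : 'M[K]_(m, n)) (w' : 'M[K]_(m', n)) :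
  injective (comb w') -> range (comb w') `<=` range (comb w) ->
  exists2 C : 'M[k]_(m', m), row_free C & w' = map_mx cst C *m w.
Proof.
move=> inj sub; have /choice[u hu] : forall i, exists c, comb w c = row i w'.
  move=> i; have [|c _ E] := sub (row i w'); last by exists c.
  by exists (delta_mx 0 i) => //; exact: comb_delta.
pose C := \matrix_i u i.
have Ew : w' = map_mx cst C *m w.
  by apply/row_matrixP => i; rewrite row_mul -map_row rowK -hu.
exists C => //; rewrite -kermx_eq0;
  apply: contraT => /rowV0Pn[c /sub_kermxP cC].
have : comb w' c = comb w' 0.
  by rewrite Ew !comb_mul cC mul0mx.
by move=> /inj ->; rewrite eqxx.
Qed.

Lemma lat_comb p m n r (w : 'M[K]_(m, n)) (g : 'M[K]_(r, n)) c :
  (forall i, lat p g (row i w)) -> lat p g (comb w c).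
Proof.
move=> wg; rewrite /comb mulmx_sum_row; apply: lat_sum => i _.
by apply: latZ => //; rewrite mxE reg_cst.
Qed.

End SplitBundles.

(** * Slopes and stability *)

Lemma sum_ltn n t : (t <= n)%N -> (\sum_(i < n) (i < t) = t)%N.
Proof.
move=> tn; transitivity (\sum_(i < n | (i < t)%N) 1)%N.
  by rewrite [RHS]big_mkcond; apply: eq_bigr => i _; case: ltnP.
by rewrite (big_ord_narrow tn) sum1_card card_ord.
Qed.

Lemma slope_lt_positive (R : realType) (alpha : R) (n : nat) (d : int) m m' :
  (0 < n)%N -> (m' < m)%N -> 0 < alpha ->
    slope alpha n d m' < slope alpha n d m.
Proof.
move=> n0 mm a0; rewrite /slope ltrD2l ltr_pM2l // ltr_pM2r ?ltr_nat //.
by rewrite invr_gt0 ltr0n.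
Qed.

Section Existence.
Context {k : closedFieldType}.
Local Notation K := (ratfunField k).
Implicit Types (n : nat) (a t : int).

Definition balanced_twists n a t (i : 'I_n) : int := a - (i < `|t|)%N%:Z.

Definition generic_system n a t : system k n :=
  System (split_bundle (@balanced_twists n a t) 1%:M)
         (range (comb (linear_sections n : 'M[K]_(n.+1, n)))).

Lemma balanced_twists_le n a t (i : 'I_n) : balanced_twists a t i <= a.
Proof. by rewrite /balanced_twists lerBlDr lerDl. Qed.

Lemma balanced_twists_ge1 n a t (i : 'I_n) : 0 <= t -> n%:Z <= n%:Z * a - t ->
  1 <= balanced_twists a t i.
Proof.
have := ltn_ord i; rewrite /balanced_twists => ni t0 d_ge.
by case: ltnP => /= [it|_]; nia.
Qed.

Lemma sum_balanced_twists n a t : 0 <= t -> t < n%:Z ->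
  \sum_(i < n) balanced_twists a t i = n%:Z * a - t.
Proof.
move=> t_ge0 t_lt; rewrite sumrB sumr_const card_ord -mulr_natl natz;
  congr (_ - _).
rewrite -[RHS](gez0_abs t_ge0) -{2}(@sum_ltn n `|t|) ?PoszM; last by lia.
by rewrite -(big_morph Posz PoszD (erefl _)).
Qed.

Lemma generic_coherent n a t : (0 < n)%N -> 0 <= t -> t < n%:Z ->
  n%:Z <= n%:Z * a - t ->
  coherent_system n (n%:Z * a - t) n.+1 (generic_system n a t).
Proof.
move=> n_gt0 t_ge0 t_lt d_ge;
  have f1 : row_free (1%:M : 'M[K]_n) by rewrite row_free_unit unitmx1.
split.
- exact: split_vector_bundle.
- by rewrite -(sum_balanced_twists a t_ge0 t_lt); exact: split_has_degree.
- move=> _ [c _ <-] p; apply: lat_comb => i.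
  by apply: linear_sections_regular => j; exact: balanced_twists_ge1.
- exists (linear_sections n : 'M[K]_(n.+1, n)); split=> //;
  apply: comb_inj => c.
  exact: linear_sections_inj.
Qed.

(** A subsystem of rank n changes the sections only. In rank r < n the sections
    are at most r in number and the degree is at most r a. *)
Lemma generic_stable (R : realType) (alpha : R) n a t : (0 < n)%N ->
  0 <= t -> t < n%:Z -> n%:Z <= n%:Z * a - t -> t%:~R < alpha ->
  stable alpha (n%:Z * a - t) n.+1 (generic_system n a t).
Proof.
move=> n0 t_ge0 t_lt d_ge alpha_gt.
have cS := generic_coherent n0 t_ge0 t_lt d_ge;
  have alpha0 : 0 < alpha by apply: le_lt_trans alpha_gt; rewrite ler0z.
move=> r e m [E V] [r0 [_ /= degE VE
  /subspace_of_dimE[w' [winj Vw']]] sub /= VV] neq.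
rewrite /= in sub; have [C Cf Ew'] : exists2 C : 'M[k]_(m, n.+1),
    row_free C & w' = map_mx cst C *m (linear_sections n : 'M[K]_(n.+1, n)).
  by apply: sub_range_comb => //; rewrite -Vw'.
have rn := subbundle_rank sub.
case: (ltngtP r n) rn => // [rn _|rE _]; last first.
  subst r; have EE := subbundle_full sub; rewrite EE in degE neq.
  have -> : e = n%:Z * a - t.
    by apply: has_degree_unique degE _; have [] := cS.
  apply: slope_lt_positive => //; rewrite ltn_neqAle.
  have mn : (m <= n.+1)%N by rewrite -(eqP Cf) rank_leq_col.
  rewrite mn andbT; apply/eqP => mE; apply: neq; congr System.
  have Cfull : row_full C by rewrite /row_full (eqP Cf) mE.
  apply/seteqP; split=> // _ [c _ <-]; rewrite Vw'.
  have /submxP[c' ->] := submx_full c Cfull.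
  by exists c' => //; rewrite -/(comb w' c') Ew' comb_mul.
have rkw' : (\rank w' <= r)%N.
  apply: (has_degree_rank degE) => i; apply: VE; rewrite Vw'.
  by exists (delta_mx 0 i) => //; exact: comb_delta.
have mr : (m <= r)%N.
  move: rkw'; have [wf|wn] := linear_sections_rank (K := K) Cf; rewrite Ew'.
    by rewrite (eqP wf).
  by rewrite wn leqNgt rn.
have er : e <= r%:Z * a.
  by apply: (subbundle_degree_le degE _ (@balanced_twists_le n a t));
    exact: subbundle_sub sub.
have r0R : 0 < r%:R :> R by rewrite ltr0n.
have n0R : 0 < n%:R :> R by rewrite ltr0n.
apply: (@le_lt_trans _ _ (a%:~R + alpha)).
  apply: lerD.
    rewrite ler_pdivrMr // mulrC;
      have : e%:~R <= (r%:Z * a)%:~R :> R by rewrite ler_int.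
    by rewrite intrM.
  by rewrite ler_piMr ?(ltW alpha0) // ler_pdivrMr // mul1r ler_nat.
have -> : slope alpha n (n%:Z * a - t) n.+1 =
    a%:~R + alpha + (alpha - t%:~R) / n%:R.
  rewrite /slope intrB intrM -natr1; field.
  by rewrite pnatr_eq0 -lt0n.
by rewrite ltrDl divr_gt0 // subr_gt0.
Qed.
End Existence.

Section Bound.
Context {k : closedFieldType}.
Local Notation K := (ratfunField k).
Context {R : realType}.

(** Compare with the subsystem that has the same bundle and no section. *)
Lemma stable_alpha_gt0 (alpha : R) n d m (S : system k n) : (0 < n)%N ->
  coherent_system n d m.+1 S -> stable alpha d m.+1 S -> 0 < alpha.
Proof.
move=> n0 [bE degE VE /subspace_of_dimE[w [winj Vw]]] st.
pose S' := System (bundle S) [set (0 : 'rV[K]_n)].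
have S'S : coherent_subsystem n d 0 S' S.
  have z0 : sections S (0 : 'rV[K]_n).
    by rewrite Vw; exists 0 => //; rewrite /comb map_mx0 mul0mx.
  split=> //; last by move=> _ ->.
  - split=> //; first by move=> _ ->; exact: VE.
    exists (0 : 'M[K]_(0, n)); split.
      by move=> c c' _; apply/rowP; case.
    apply/seteqP; split=> [_ ->|_ [c _ <-]]; last by rewrite mulmx0.
    by exists 0 => //; rewrite mulmx0.
  - exact: subbundle_refl.
have neq : S' <> S.
  move=> E; have V0 : sections S = [set (0 : 'rV[K]_n)] by rewrite -E.
  have z c : comb w c = 0.
    by have : sections S (comb w c); [rewrite Vw; exists c|rewrite V0].
  have /rowP/(_ ord0)/eqP : const_mx 1 = 0 :> 'rV[k]_m.+1.
    by apply: winj; rewrite !z.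
  by rewrite !mxE oner_eq0.
have := st _ _ _ _ S'S neq; rewrite /slope mul0r mulr0 ltrD2l.
by rewrite pmulr_lgt0 // divr_gt0 // ltr0n.
Qed.

(** Dropping a summand of minimal degree a_j <= 0 destabilizes: at most one
    dimension of sections is lost, and the slope of the bundle does not go down
    because a_j is at most the average of the a_i. *)
Lemma stable_degree_ge (alpha : R) n d (S : system k n.+1) : (0 < n)%N ->
  coherent_system n.+1 d n.+2 S -> stable alpha d n.+2 S -> n.+1%:Z <= d.
Proof.
move=> n0 cS st; have alpha0 := stable_alpha_gt0 (isT : (0 < n.+1)%N) cS st.
case: S cS st => E V [/= bE degE VE /subspace_of_dimE[w [winj Vw]]] st.
rewrite leNgt; apply/negP => dn.
have [a [g [gu Ea]]] := vector_bundle_split bE; subst E.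
have gf : row_free g by rewrite row_free_unit.
have dE : d = \sum_i a i.
  by apply: has_degree_unique degE _; exact: split_has_degree.
pose j := [arg min_(i < ord0) a i]%O.
have jmin i : a j <= a i.
  by rewrite /j; case: Order.TotalTheory.arg_minP => // l _; apply.
have nd : n.+1%:Z * a j <= d.
  have : \sum_(i < n.+1) a j <= \sum_i a i by apply: ler_sum => i _;
    exact: jmin.
  by rewrite sumr_const card_ord -mulr_natl natz dE.
have aj : a j <= 0 by nia.
have wg p i : lat p (twist p a g) (row i w).
  by apply: VE; rewrite Vw; exists (delta_mx 0 i) => //; exact: comb_delta.
have [eta Heta] := coordinate_constant gu aj wg.
(* the rows of C span the combinations whose j-th coordinate vanishes *)
pose C := row_base (kermx eta); set m := \rank (kermx eta) in C.
have mn : (n.+1 <= m)%N.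
  by rewrite /m mxrank_ker; have := rank_leq_col eta; lia.
pose w' : 'M[K]_(m, n.+1) := map_mx cst C *m w.
have w'j i : (w' *m invmx g) i j = 0.
  have : col j (w' *m invmx g) = 0.
    have -> : col j (w' *m invmx g) = map_mx cst C *m col j (w *m invmx g).
      by rewrite !colE /w' !mulmxA.
    rewrite Heta -map_mxM.
    have -> : C *m eta = 0 by apply/sub_kermxP; rewrite eq_row_base.
    by rewrite map_mx0.
  by move=> /colP/(_ i); rewrite !mxE.
pose F := split_bundle (a \o lift j) (row' j g).
pose S' := System F (range (comb w')).
have V'V : range (comb w') `<=` V.
  move=> _ [c _ <-]; rewrite Vw; exists (c *m C) => //.
  by rewrite -/(comb w _) -comb_mul.
have rowF p i : lat p (twist p (a \o lift j) (row' j g)) (row i w').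
  have : lat p (twist p a g) (row i w').
    by apply: VE; apply: V'V; exists (delta_mx 0 i) => //; exact: comb_delta.
  move=> [u up Eu]; exists (col' j u).
    by apply/mxOverP => x y; rewrite mxE (mxOverP up).
  have uj : u 0 j = 0.
    have : (row i w' *m invmx g) 0 j = 0 by rewrite -row_mul mxE w'j.
    rewrite Eu twistE mulmxA mulmxK // mul_mx_diag !mxE => /eqP.
    by rewrite mulf_eq0 (negbTE (twist_factor_neq0 _ _)) orbF => /eqP.
  rewrite Eu; apply/rowP => y; rewrite [LHS]mxE (bigD1 j) //= uj mul0r add0r.
  rewrite [RHS]mxE.
  rewrite (reindex_onto (lift j)
    (fun i => odflt (Ordinal n0) (unlift j i))) /=.
    apply: eq_big => [x|x _]; last by rewrite !mxE.
    by rewrite eq_sym neq_lift liftK eqxx.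
  by move=> x xj; case: unliftP => [l ->//|xE]; rewrite xE eqxx in xj.
have rf : row_free (row' j g).
  have := row_free_col_row' j gu; rewrite -!row_leq_rank => h.
  have := mxrank_adds_leqif (row' j g) (row j g); rewrite addsmxE => -[h' _].
  have := leq_trans h h'; have := rank_leq_row (row j g); lia.
have degF : has_degree n F (d - a j).
  have -> : d - a j = \sum_i (a \o lift j) i.
    rewrite dE (bigD1_ord j) //= addrAC subrr add0r; apply: eq_bigr => i _ //.
  exact: split_has_degree.
have S'S : coherent_subsystem n (d - a j) m S' (System (split_bundle a g) V).
  split=> //; last exact: split_subbundle_row'.
  split=> //=.
  - exact: split_vector_bundle.
  - by move=> _ [c _ <-] p; apply: lat_comb => i; exact: rowF.
  - exists w'; split=> //; apply: comb_inj => c; rewrite comb_mul => c0.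
    have /winj cC : comb w (c *m C) = comb w 0.
      by rewrite c0 /comb map_mx0 mul0mx.
    have Cf : row_free C by exact: row_base_free.
    by apply: (row_free_inj Cf); rewrite cC mul0mx.
have neq : S' <> System (split_bundle a g) V.
  case=> /(congr1 (fun E : stalks k n.+1 => E None)) FE _.
  have := mxrankS (_ : (twist None a g <= row' j g)%MS).
  have : (twist None a g <= row' j g)%MS.
    apply/row_subP => i; have := lat_row (K := K) None (twist None a g) i.
    have -> : lat None (twist None a g) = F None by rewrite FE.
    by move=> [u _ ->]; rewrite twistE mulmxA submxMl.
  move=> /mxrankS; have /eqP-> := twist_free None a gf.
  by rewrite leqNgt ltnS rank_leq_row.
have := st _ _ _ _ S'S neq; apply/negP; rewrite -leNgt /slope.
have n1R : 0 < n.+1%:R :> R by rewrite ltr0n.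
have nR : 0 < n%:R :> R by rewrite ltr0n.
apply: lerD.
  rewrite ler_pdivrMr // mulrAC ler_pdivlMr // !pmulrn -!intrM ler_int.
  nia.
rewrite ler_pM2l // ler_pdivrMr // mulrAC ler_pdivlMr // -!natrM ler_nat.
nia.
Qed.
End Bound.

Theorem proposition6p4 (R : realType) (k : closedFieldType) (n : nat) (d : int)
    (n_ge2 : (2 <= n)%N) :
  ((exists alpha : R, moduli k alpha n d n.+1 !=set0) <-> n%:Z <= d) /\
  (n%:Z <= d ->
   forall a t : int, d = n%:Z * a - t -> 0 <= t -> t < n%:Z ->
   forall alpha : R, t%:~R < alpha -> moduli k alpha n d n.+1 !=set0).
Proof.
have nonempty : n%:Z <= d -> forall a t : int, d = n%:Z * a - t -> 0 <= t ->
    t < n%:Z -> forall alpha : R, t%:~R < alpha ->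
    moduli k alpha n d n.+1 !=set0.
  move=> nd a t dE t0 tn alpha ta; rewrite dE in nd *.
  exists [set S' | isomorphic (generic_system n a t) S'].
  exists (generic_system n a t); split=> //.
    by apply: generic_coherent => //; exact: ltnW.
  by apply: generic_stable => //; exact: ltnW.
split=> //; split=> [[alpha [_ [S [cS st _]]]]|nd].
  case: n n_ge2 S cS st {nonempty} => // n n0 S cS st.
  exact: stable_degree_ge cS st.
pose t := ((- d) %% n%:Z)%Z.
have n0 : n%:Z != 0 by lia.
exists (t%:~R + 1); apply: (nonempty nd (- ((- d) %/ n%:Z)%Z) t).
- by have := divz_eq (- d) n%:Z; rewrite -/t; lia.
- exact: modz_ge0.
- by apply: ltz_pmod; lia.
- by rewrite ltrDl.
Qed.
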